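(* Let $L=\{L_i\}_{i\ge1}$ be a graded Lie algebra over a field of characteristic zero such that $\dim L_i<\infty$ for all $i$. Then the center of the universal enveloping algebra $UL$ is contained in the enveloping algebra of the radical of $L$: $Z(UL)\subset UR(L)$.
   Context: $UL$ is the universal enveloping algebra of the graded Lie algebra $L$. $Z(UL)$ is its center in the graded sense (elements whose graded commutator with every element of $UL$ vanishes). The radical $R(L)$ is the sum of all solvable ideals of $L$; $UR(L)$ is regarded as a subalgebra of $UL$. *)

(* Defs.v *)
From HB Require Import structures.
From mathcomp Require Import all_boot all_order all_algebra generic_quotient.
From mathcomp Require Import boolp classical_sets.

Set Implicit Arguments.
Unset Strict Implicit.
Unset Printing Implicit Defensive.

Import GRing.Theory.
Local Open Scope ring_scope.
Local Open Scope classical_set_scope.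
Local Open Scope quotient_scope.

(** Graded Lie algebras L = {L_i}_{i >= 1} of finite type: [L i] is a
  finite-dimensional space for every [i], and [L 0] is zero.  The bracket
  L_i x L_j -> L_{i+j} takes a proof of [i + j = n] and lands in [L n], so that
  the identities below compare elements of the same type.

  The axioms are those for a base field of characteristic zero: in
  characteristics 2 and 3 one also has to ask for [x, x] = 0 (x even) and
  [x, [x, x]] = 0 (x odd). *)
Record gradedLie (k : fieldType) := GradedLie {
  lie_comp :> nat -> vectType k;
  br : forall i j n, (i + j)%N = n -> lie_comp i -> lie_comp j -> lie_comp n;
  lie_comp0 : forall x : lie_comp 0, x = 0;
  br_linearl : forall i j n (e : (i + j)%N = n) (y : lie_comp j) a x x',
    br e (a *: x + x') y = a *: br e x y + br e x' y;
  br_linearr : forall i j n (e : (i + j)%N = n) (x : lie_comp i) a y y',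
    br e x (a *: y + y') = a *: br e x y + br e x y';
  br_anti : forall i j n (e : (i + j)%N = n) (e' : (j + i)%N = n) x y,
    br e x y = - ((-1) ^+ (i * j) *: br e' y x);
  br_jacobi : forall i j l ij jl il n
      (eij : (i + j)%N = ij) (ejl : (j + l)%N = jl) (eil : (i + l)%N = il)
      (e1 : (i + jl)%N = n) (e2 : (ij + l)%N = n) (e3 : (j + il)%N = n) x y z,
    br e1 x (br ejl y z) =
      br e2 (br eij x y) z + (-1) ^+ (i * j) *: br e3 y (br eil x z)
}.

Lemma setspan_exists (k : fieldType) (V : vectType k) (A : set V) :
  exists U : {vspace V}, (forall x, A x -> x \in U) /\
    forall W : {vspace V}, (forall x, A x -> x \in W) -> (U <= W)%VS.
Proof.
pose P n := `[< exists2 W : {vspace V}, (forall x, A x -> x \in W) & \dim W = n >].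
have exP : exists n, P n.
  by exists (\dim {: V}); apply/asboolP; exists fullv => // x _; exact: memvf.
case: (ex_minnP exP) => n /asboolP[U AU dU] minU.
exists U; split=> // W AW.
suff -> : U = (U :&: W)%VS by exact: capvSr.
apply/esym/eqP; rewrite eqEdim capvSl dU; apply: minU; apply/asboolP.
by exists (U :&: W)%VS => // x Ax; rewrite memv_cap AU ?AW.
Qed.

Definition setspan (k : fieldType) (V : vectType k) (A : set V) : {vspace V} :=
  projT1 (cid (setspan_exists A)).

Lemma mem_setspan (k : fieldType) (V : vectType k) (A : set V) x :
  A x -> x \in setspan A.
Proof. by rewrite /setspan; case: cid => U [/= + _]; apply. Qed.

Lemma setspan_min (k : fieldType) (V : vectType k) (A : set V) (W : {vspace V}) :
  (forall x, A x -> x \in W) -> (setspan A <= W)%VS.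
Proof. by rewrite /setspan; case: cid => U [/= _ +]; apply. Qed.

Definition graded_subspace (k : fieldType) (L : gradedLie k) :=
  forall n, {vspace L n}.

Definition lie_subalgebra (k : fieldType) (L : gradedLie k)
    (K : graded_subspace L) : Prop :=
  forall i j n (e : (i + j)%N = n) x y,
    x \in K i -> y \in K j -> br e x y \in K n.

Definition lie_ideal (k : fieldType) (L : gradedLie k)
    (I : graded_subspace L) : Prop :=
  forall i j n (e : (i + j)%N = n) x y, y \in I j -> br e x y \in I n.

Definition derived (k : fieldType) (L : gradedLie k)
    (K : graded_subspace L) : graded_subspace L :=
  fun n => setspan [set z | exists i j (e : (i + j)%N = n) x y,
    [/\ x \in K i, y \in K j & z = br e x y]].

Definition solvable (k : fieldType) (L : gradedLie k)
    (K : graded_subspace L) : Prop :=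
  exists s, forall n, iter s (@derived k L) K n = 0%VS.

(** The sum of all solvable ideals, in each degree the span of their union. *)
Definition radical (k : fieldType) (L : gradedLie k) : graded_subspace L :=
  fun n => setspan [set x | exists I : graded_subspace L,
    [/\ lie_ideal I, solvable I & x \in I n]].

Lemma radical_ideal (k : fieldType) (L : gradedLie k) : lie_ideal (radical L).
Proof.
move=> i j n e x y yR.
pose fM := GRing.isLinear.Build k (L j) (L n) *:%R (br e x)
  (fun a u v => br_linearr e x a u v).
pose f : {linear L j -> L n} := HB.pack (br e x) fM.
have fE v : linfun f v = br e x v by rewrite lfunE.
suff : (radical L j <= linfun f @^-1: radical L n)%VS.
  by move=> /subvP/(_ y yR); rewrite -memv_preim fE.
apply: setspan_min => v [I [Ii Is vI]].
rewrite -memv_preim fE; apply: mem_setspan; exists I; split=> //.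
exact: Ii.
Qed.

Lemma radical_subalgebra (k : fieldType) (L : gradedLie k) :
  lie_subalgebra (radical L).
Proof. by move=> i j n e x y _; exact: radical_ideal. Qed.

Section SubLie.
Context (k : fieldType) (L : gradedLie k) (K : graded_subspace L).
Context (subK : lie_subalgebra K).

Let S n : vectType k := subvs_of (K n).

Let sbr i j n (e : (i + j)%N = n) (x : S i) (y : S j) : S n :=
  vsproj (K n) (br e (vsval x) (vsval y)).

Let sbrE i j n (e : (i + j)%N = n) (x : S i) (y : S j) :
  vsval (sbr e x y) = br e (vsval x) (vsval y).
Proof. by rewrite vsprojK // subK ?subvsP. Qed.

Let vsvalP n a (u v : S n) : vsval (a *: u + v) = a *: vsval u + vsval v.
Proof. exact: linearP. Qed.

Let vsval_inj n (u v : S n) : vsval u = vsval v -> u = v.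
Proof. exact: val_inj. Qed.

Let sbr0 (x : S 0) : x = 0.
Proof. by apply: vsval_inj; rewrite /= [LHS]lie_comp0 [RHS]lie_comp0. Qed.

Let sbr_linearl i j n (e : (i + j)%N = n) (y : S j) a (x x' : S i) :
  sbr e (a *: x + x') y = a *: sbr e x y + sbr e x' y.
Proof. by apply: vsval_inj; rewrite [RHS]vsvalP !sbrE vsvalP br_linearl. Qed.

Let sbr_linearr i j n (e : (i + j)%N = n) (x : S i) a (y y' : S j) :
  sbr e x (a *: y + y') = a *: sbr e x y + sbr e x y'.
Proof. by apply: vsval_inj; rewrite [RHS]vsvalP !sbrE vsvalP br_linearr. Qed.

Let sbr_anti i j n (e : (i + j)%N = n) (e' : (j + i)%N = n) (x : S i) (y : S j) :
  sbr e x y = - ((-1) ^+ (i * j) *: sbr e' y x).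
Proof.
apply: vsval_inj; rewrite -scaleNr.
by rewrite -[_ *: _]addr0 [RHS]vsvalP !sbrE linear0 addr0 scaleNr -br_anti.
Qed.

Let sbr_jacobi i j l ij jl il n
    (eij : (i + j)%N = ij) (ejl : (j + l)%N = jl) (eil : (i + l)%N = il)
    (e1 : (i + jl)%N = n) (e2 : (ij + l)%N = n) (e3 : (j + il)%N = n)
    (x : S i) (y : S j) (z : S l) :
  sbr e1 x (sbr ejl y z) =
    sbr e2 (sbr eij x y) z + (-1) ^+ (i * j) *: sbr e3 y (sbr eil x z).
Proof.
apply: vsval_inj; rewrite [X in _ = vsval X]addrC [RHS]vsvalP !sbrE addrC.
exact: br_jacobi.
Qed.

Definition subLie : gradedLie k :=
  GradedLie sbr0 sbr_linearl sbr_linearr sbr_anti sbr_jacobi.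

End SubLie.

(** [U L] is the associative unital k-algebra generated by the elements of the
  [L i], subject to the linear relations of the [L i] and to
    [x, y] = x y - (-1)^{ij} y x      (x in L_i, y in L_j),
  i.e. the quotient of the tensor algebra of L by the latter relations.  It is
  the set of noncommutative polynomial expressions modulo the least congruence
  containing these relations and the laws of an algebra; its universal
  property is [ulift_morphism], [uliftE] and [ulift_unique] below. *)

Inductive uterm (k : fieldType) (L : gradedLie k) : Type :=
  | UConst of k
  | UGen i of L i
  | UAdd of uterm L & uterm L
  | UMul of uterm L & uterm L.
Arguments UConst {k L}.
Arguments UGen {k L i}.

Inductive ucong (k : fieldType) (L : gradedLie k) : uterm L -> uterm L -> Prop :=
  | UC_refl t : ucong t t
  | UC_sym t u : ucong t u -> ucong u t
  | UC_trans t u v : ucong t u -> ucong u v -> ucong t v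
  | UC_add t t' u u' : ucong t t' -> ucong u u' -> ucong (UAdd t u) (UAdd t' u')
  | UC_mul t t' u u' : ucong t t' -> ucong u u' -> ucong (UMul t u) (UMul t' u')
  | UC_addA t u v : ucong (UAdd t (UAdd u v)) (UAdd (UAdd t u) v)
  | UC_addC t u : ucong (UAdd t u) (UAdd u t)
  | UC_add0 t : ucong (UAdd (UConst 0) t) t
  | UC_mulA t u v : ucong (UMul t (UMul u v)) (UMul (UMul t u) v)
  | UC_mul0 t : ucong (UMul (UConst 0) t) (UConst 0)
  | UC_mul1 t : ucong (UMul (UConst 1) t) t
  | UC_mulDl t u v : ucong (UMul (UAdd t u) v) (UAdd (UMul t v) (UMul u v))
  | UC_mulDr t u v : ucong (UMul t (UAdd u v)) (UAdd (UMul t u) (UMul t v))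
  | UC_constD a b : ucong (UConst (a + b)) (UAdd (UConst a) (UConst b))
  | UC_constM a b : ucong (UConst (a * b)) (UMul (UConst a) (UConst b))
  | UC_constC a t : ucong (UMul (UConst a) t) (UMul t (UConst a))
  | UC_lin i a (x y : L i) :
      ucong (UGen (a *: x + y)) (UAdd (UMul (UConst a) (UGen x)) (UGen y))
  | UC_br i j n (e : (i + j)%N = n) (x : L i) (y : L j) :
      ucong (UGen (br e x y))
        (UAdd (UMul (UGen x) (UGen y))
              (UMul (UConst (- (-1) ^+ (i * j))) (UMul (UGen y) (UGen x)))).

HB.instance Definition _ (k : fieldType) (L : gradedLie k) :=
  gen_eqMixin (uterm L).
HB.instance Definition _ (k : fieldType) (L : gradedLie k) :=
  gen_choiceMixin (uterm L).

Definition ucongb (k : fieldType) (L : gradedLie k) : rel (uterm L) :=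
  fun t u => `[< ucong t u >].

Lemma ucongb_refl (k : fieldType) (L : gradedLie k) : reflexive (@ucongb k L).
Proof. by move=> t; apply/asboolP/UC_refl. Qed.
Lemma ucongb_sym (k : fieldType) (L : gradedLie k) : symmetric (@ucongb k L).
Proof. by move=> t u; apply/asboolP/asboolP => /UC_sym. Qed.
Lemma ucongb_trans (k : fieldType) (L : gradedLie k) : transitive (@ucongb k L).
Proof. by move=> u t v /asboolP tu /asboolP uv; apply/asboolP/(UC_trans tu). Qed.

Canonical ucong_equiv (k : fieldType) (L : gradedLie k) :=
  EquivRel (@ucongb k L) (@ucongb_refl k L) (@ucongb_sym k L)
    (@ucongb_trans k L).

Definition U (k : fieldType) (L : gradedLie k) : Type :=
  {eq_quot (@ucongb k L)}.

HB.instance Definition _ (k : fieldType) (L : gradedLie k) :=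
  Choice.on (U L).

Definition upi (k : fieldType) (L : gradedLie k) (t : uterm L) : U L :=
  \pi_{eq_quot (@ucongb k L)} t.
Definition urepr (k : fieldType) (L : gradedLie k) (u : U L) : uterm L :=
  repr (u : {eq_quot (@ucongb k L)}).

Lemma ureprK (k : fieldType) (L : gradedLie k) : cancel (@urepr k L) (@upi k L).
Proof. by move=> u; rewrite /upi /urepr reprK. Qed.

Lemma upiP (k : fieldType) (L : gradedLie k) (t u : uterm L) :
  upi t = upi u <-> ucong t u.
Proof.
rewrite /upi; split=> [|tu].
  by move=> /(eqmodP (ucong_equiv L))/asboolP.
by apply/(eqmodP (ucong_equiv L)); apply/asboolP.
Qed.

Lemma urepr_pi (k : fieldType) (L : gradedLie k) (t : uterm L) :
  ucong (urepr (upi t)) t.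
Proof. by apply/upiP; rewrite ureprK. Qed.

(** Evaluation of expressions in a ring [A], the scalars being sent to [A] by
    [sc] and the elements of L by [g]. *)
Fixpoint ueval (k : fieldType) (L : gradedLie k) (A : pzRingType)
    (sc : k -> A) (g : forall i, L i -> A) (t : uterm L) : A :=
  match t with
  | UConst c => sc c
  | UGen i x => g i x
  | UAdd t u => ueval sc g t + ueval sc g u
  | UMul t u => ueval sc g t * ueval sc g u
  end.

Lemma ueval_cong (k : fieldType) (L : gradedLie k) (A : pzRingType)
    (sc : {rmorphism k -> A}) (g : forall i, L i -> A) :
  (forall a b, sc a * b = b * sc a) ->
  (forall i a (x y : L i), g i (a *: x + y) = sc a * g i x + g i y) ->
  (forall i j n (e : (i + j)%N = n) (x : L i) (y : L j),
    g n (br e x y) = g i x * g j y - sc ((-1) ^+ (i * j)) * (g j y * g i x)) ->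
  forall t u, ucong t u -> ueval sc g t = ueval sc g u.
Proof.
move=> scC gl gb t u; elim=> //=.
- by move=> ? ? ? _ -> _ ->.
- by move=> ? ? ? ? _ -> _ ->.
- by move=> ? ? ? ? _ -> _ ->.
- by move=> *; rewrite addrA.
- by move=> *; rewrite addrC.
- by move=> *; rewrite rmorph0 add0r.
- by move=> *; rewrite mulrA.
- by move=> *; rewrite rmorph0 mul0r.
- by move=> *; rewrite rmorph1 mul1r.
- by move=> *; rewrite mulrDl.
- by move=> *; rewrite mulrDr.
- by move=> *; rewrite rmorphD.
- by move=> *; rewrite rmorphM.
- by move=> i j n e x y; rewrite gb rmorphN mulNr.
Qed.

Section UAlgebra.
Context (k : fieldType) (L : gradedLie k).
Implicit Types u v w : U L.

Let z0 : U L := upi (UConst 0).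
Let o1 : U L := upi (UConst 1).
Let add u v : U L := upi (UAdd (urepr u) (urepr v)).
Let mul u v : U L := upi (UMul (urepr u) (urepr v)).
Let scl (a : k) u : U L := mul (upi (UConst a)) u.
Let opp u : U L := scl (-1) u.

Let upi_add t t' : upi (UAdd t t') = add (upi t) (upi t').
Proof. by apply/upiP; apply: UC_add; apply/UC_sym/urepr_pi. Qed.
Let upi_mul t t' : upi (UMul t t') = mul (upi t) (upi t').
Proof. by apply/upiP; apply: UC_mul; apply/UC_sym/urepr_pi. Qed.
Let pE := (upi_add, upi_mul).

Let addA : associative add.
Proof.
move=> u v w; rewrite -(ureprK u) -(ureprK v) -(ureprK w) -!pE.
exact/upiP/UC_addA.
Qed.
Let addC : commutative add.
Proof. by move=> u v; rewrite -(ureprK u) -(ureprK v) -!pE; exact/upiP/UC_addC. Qed.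
Let add0 : left_id z0 add.
Proof. by move=> u; rewrite -(ureprK u) -!pE; exact/upiP/UC_add0. Qed.
Let mulA : associative mul.
Proof.
move=> u v w; rewrite -(ureprK u) -(ureprK v) -(ureprK w) -!pE.
exact/upiP/UC_mulA.
Qed.
Let mul0 : left_zero z0 mul.
Proof. by move=> u; rewrite -(ureprK u) -!pE; exact/upiP/UC_mul0. Qed.
Let mul1 : left_id o1 mul.
Proof. by move=> u; rewrite -(ureprK u) -!pE; exact/upiP/UC_mul1. Qed.
Let constC a u : mul (upi (UConst a)) u = mul u (upi (UConst a)).
Proof. by rewrite -(ureprK u) -!pE; exact/upiP/UC_constC. Qed.
Let mulr1 : right_id o1 mul.
Proof. by move=> u; rewrite -constC mul1. Qed.
Let mulDl : left_distributive mul add.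
Proof.
move=> u v w; rewrite -(ureprK u) -(ureprK v) -(ureprK w) -!pE.
exact/upiP/UC_mulDl.
Qed.
Let mulDr : right_distributive mul add.
Proof.
move=> u v w; rewrite -(ureprK u) -(ureprK v) -(ureprK w) -!pE.
exact/upiP/UC_mulDr.
Qed.
Let constD a b : upi (UConst (a + b)) = add (upi (UConst a)) (upi (UConst b)).
Proof. by rewrite -!pE; exact/upiP/UC_constD. Qed.
Let constM a b : upi (UConst (a * b)) = mul (upi (UConst a)) (upi (UConst b)).
Proof. by rewrite -!pE; exact/upiP/UC_constM. Qed.
Let addN : left_inverse z0 opp add.
Proof.
by move=> u; rewrite /opp /scl -{2}(mul1 u) -mulDl -constD addNr mul0.
Qed.
Let one_neq0 : o1 != z0.
Proof.
apply/eqP => /upiP h.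
have := @ueval_cong k L k idfun (fun _ _ => 0) _ _ _ _ _ h.
move=> /(_ (fun a b => mulrC a b)) /= H.
have /eqP := H (fun _ _ _ _ => esym (etrans (addr0 _) (mulr0 _)))
  (fun _ _ _ _ _ _ => esym (etrans (congr1 (fun z => 0 * 0 - z)
    (etrans (congr1 (fun z => _ * z) (mulr0 0)) (mulr0 _)))
    (etrans (subr0 _) (mulr0 _)))).
by rewrite oner_eq0.
Qed.

HB.instance Definition _ := GRing.isZmodule.Build (U L) addA addC add0 addN.
HB.instance Definition _ :=
  GRing.Zmodule_isNzRing.Build (U L) mulA mul1 mulr1 mulDl mulDr one_neq0.

Let sclA a b u : scl a (scl b u) = scl (a * b) u.
Proof. by rewrite /scl mulA constM. Qed.
Let scl1 : left_id 1 scl.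
Proof. exact: mul1. Qed.
Let sclDr : right_distributive scl +%R.
Proof. by move=> a u v; exact: mulDr. Qed.
Let sclDl u : {morph scl^~ u : a b / a + b}.
Proof. by move=> a b; rewrite /scl constD; exact: mulDl. Qed.

HB.instance Definition _ :=
  GRing.Zmodule_isLmodule.Build k (U L) sclA scl1 sclDr sclDl.

Let sclAl a u v : a *: (u * v) = (a *: u) * v.
Proof. exact: mulA. Qed.
HB.instance Definition _ := GRing.Lmodule_isLalgebra.Build k (U L) sclAl.

Let sclAr a u v : a *: (u * v) = u * (a *: v).
Proof.
rewrite [LHS]mulA [RHS]mulA; congr mul; exact: constC.
Qed.
HB.instance Definition _ := GRing.Lalgebra_isAlgebra.Build k (U L) sclAr.

Lemma upiD t t' : upi (UAdd t t') = upi t + upi t' :> U L.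
Proof. exact: upi_add. Qed.
Lemma upiM t t' : upi (UMul t t') = upi t * upi t' :> U L.
Proof. exact: upi_mul. Qed.
Lemma upiC a : upi (UConst a) = a%:A :> U L.
Proof. exact/esym/mulr1. Qed.

End UAlgebra.

Definition iota (k : fieldType) (L : gradedLie k) i (x : L i) : U L :=
  upi (UGen x).

Lemma iota_linear (k : fieldType) (L : gradedLie k) i a (x y : L i) :
  iota (a *: x + y) = a *: iota x + iota y.
Proof.
rewrite /iota -mulr_algl -upiC -upiM -upiD; exact/upiP/UC_lin.
Qed.

Lemma iota_br (k : fieldType) (L : gradedLie k) i j n (e : (i + j)%N = n)
    (x : L i) (y : L j) :
  iota (br e x y) = iota x * iota y - (-1) ^+ (i * j) *: (iota y * iota x).
Proof.
rewrite -scaleNr -mulr_algl /iota -upiC -!upiM -upiD; exact/upiP/UC_br.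
Qed.

(** [g] is a morphism of graded Lie algebras from L to the commutator Lie
    algebra of [A]; no grading of [A] is needed to say so. *)
Definition lie_morphism (k : fieldType) (L : gradedLie k) (A : algType k)
    (g : forall i, L i -> A) : Prop :=
  (forall i a (x y : L i), g i (a *: x + y) = a *: g i x + g i y) /\
  (forall i j n (e : (i + j)%N = n) (x : L i) (y : L j),
    g n (br e x y) = g i x * g j y - (-1) ^+ (i * j) *: (g j y * g i x)).

Definition ulift (k : fieldType) (L : gradedLie k) (A : algType k)
    (g : forall i, L i -> A) (u : U L) : A :=
  ueval (in_alg A) g (urepr u).

Lemma ulift_pi (k : fieldType) (L : gradedLie k) (A : algType k)
    (g : forall i, L i -> A) (t : uterm L) :
  lie_morphism g -> ulift g (upi t) = ueval (in_alg A) g t.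
Proof.
move=> [gl gb]; apply: ueval_cong (urepr_pi t) => [a b|i a x y|i j n e x y] /=.
- by rewrite mulr_algl mulr_algr.
- by rewrite gl mulr_algl.
- by rewrite gb mulr_algl.
Qed.

Lemma ulift_morphism (k : fieldType) (L : gradedLie k) (A : algType k)
    (g : forall i, L i -> A) :
  lie_morphism g ->
  [/\ ulift g 1 = 1,
      forall a u v, ulift g (a *: u + v) = a *: ulift g u + ulift g v &
      forall u v, ulift g (u * v) = ulift g u * ulift g v].
Proof.
move=> gP; split.
- by rewrite -(scale1r 1) -upiC ulift_pi //= !scale1r.
- move=> a u v; rewrite -(ureprK u) -(ureprK v) -mulr_algl -upiC -upiM -upiD.
  by rewrite !ulift_pi //= mulr_algl.
- move=> u v; rewrite -(ureprK u) -(ureprK v) -upiM.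
  by rewrite !ulift_pi.
Qed.

Lemma uliftE (k : fieldType) (L : gradedLie k) (A : algType k)
    (g : forall i, L i -> A) i (x : L i) :
  lie_morphism g -> ulift g (iota x) = g i x.
Proof. by move=> gP; rewrite ulift_pi. Qed.

Lemma ulift_unique (k : fieldType) (L : gradedLie k) (A : algType k)
    (g : forall i, L i -> A) (f : {lrmorphism U L -> A}) :
  lie_morphism g -> (forall i (x : L i), f (iota x) = g i x) -> f =1 ulift g.
Proof.
move=> gP fg u; rewrite -(ureprK u) ulift_pi //.
elim: (urepr u) => [c|i x|t IHt t' IHt'|t IHt t' IHt'] /=.
- by rewrite upiC linearZ /= rmorph1.
- exact: fg.
- by rewrite upiD rmorphD /= IHt IHt'.
- by rewrite upiM rmorphM /= IHt IHt'.
Qed.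

(** (UL)_n is the span of the products of elements of L of total degree n. *)
Inductive uhomog (k : fieldType) (L : gradedLie k) : nat -> U L -> Prop :=
  | uhomog1 : uhomog 0 1
  | uhomog0 n : uhomog n 0
  | uhomogP n a u v : uhomog n u -> uhomog n v -> uhomog n (a *: u + v)
  | uhomogM i j (x : L i) u : uhomog j u -> uhomog (i + j) (iota x * u).

(** The decomposition u = sum_n u_n into homogeneous components, recorded as
    the polynomial sum_n u_n 'X^n: this is the algebra morphism sending
    x in L_i to x 'X^i.  See [ucomp_homog], [ucomp_sum] and [ucomp_id]. *)
Definition ugr (k : fieldType) (L : gradedLie k) (u : U L) : {poly U L} :=
  ueval (fun c => (c%:A)%:P) (fun i x => (iota x)%:P * 'X^i) (urepr u).

Definition ucomp (k : fieldType) (L : gradedLie k) (n : nat) (u : U L) : U L :=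
  (ugr u)`_n.

(** The bilinear extension of [u, v] = u v - (-1)^{ij} v u for u in (UL)_i and
    v in (UL)_j; see [gcommE]. *)
Definition gcomm (k : fieldType) (L : gradedLie k) (u v : U L) : U L :=
  \sum_(i < size (ugr u)) \sum_(j < size (ugr v))
    (ucomp i u * ucomp j v - (-1) ^+ (i * j) *: (ucomp j v * ucomp i u)).

Definition Z (k : fieldType) (L : gradedLie k) : set (U L) :=
  [set z | forall u, gcomm z u = 0].
Arguments Z {k} L.

Section UGrading.
Context (k : fieldType) (L : gradedLie k).
Implicit Types u v w : U L.

Let scP : {rmorphism k -> {poly U L}} := polyC \o in_alg (U L).

Let mul_polyCXn (c d : U L) p q :
  c%:P * 'X^p * (d%:P * 'X^q) = (c * d)%:P * 'X^(p + q) :> {poly U L}.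
Proof.
by rewrite -mulrA [X in _ * X]mulrA -commr_polyXn polyCM exprD !mulrA.
Qed.

Let ugr_pi (t : uterm L) : ugr (upi t) =
  ueval (fun c => (c%:A)%:P) (fun i (x : L i) => (iota x)%:P * 'X^i) t.
Proof.
apply: (@ueval_cong k L {poly U L} scP) (urepr_pi t) => /=.
- move=> a p; apply/polyP => n; rewrite coefCM coefMC.
  by rewrite mulr_algl mulr_algr.
- move=> i a x y; rewrite iota_linear polyCD mulrDl mulrA -polyCM.
  by rewrite mulr_algl.
- move=> i j n e x y; rewrite iota_br -{n}e.
  rewrite !mul_polyCXn [(j + i)%N]addnC mulrA -polyCM mulr_algl.
  by rewrite -mulrBl -polyCB.
Qed.

Lemma ugrM u v : ugr (u * v) = ugr u * ugr v.
Proof. by rewrite -(ureprK u) -(ureprK v) -upiM !ugr_pi. Qed.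
Lemma ugrD u v : ugr (u + v) = ugr u + ugr v.
Proof. by rewrite -(ureprK u) -(ureprK v) -upiD !ugr_pi. Qed.
Lemma ugrC a : ugr (a%:A : U L) = (a%:A)%:P.
Proof. by rewrite -[in LHS]upiC ugr_pi. Qed.
Lemma ugrZ a u : ugr (a *: u) = a%:A *: ugr u.
Proof. by rewrite -[a *: u]mulr_algl ugrM ugrC mul_polyC. Qed.
Lemma ugr_iota i (x : L i) : ugr (iota x) = (iota x)%:P * 'X^i.
Proof. by rewrite ugr_pi. Qed.

Lemma ucomp_id n u : uhomog n u -> forall m, ucomp m u = if m == n then u else 0.
Proof.
suff H : uhomog n u -> ugr u = u%:P * 'X^n.
  by move=> /H E m; rewrite /ucomp E coefCM coefXn; case: eqP; rewrite ?mulr1 ?mulr0.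
elim=> {n u}.
- by rewrite -[1](scale1r 1) ugrC expr0 mulr1.
- by move=> n; rewrite -[0](scale0r 1) ugrC scale0r polyC0 mul0r.
- move=> n a u v _ Eu _ Ev; rewrite ugrD ugrZ Eu Ev polyCD mulrDl; congr (_ + _).
  by rewrite -mul_polyC mulrA -polyCM mulr_algl.
- move=> i j x u _ Eu; rewrite ugrM ugr_iota Eu.
  exact: mul_polyCXn.
Qed.

Lemma uhomogD n u v : uhomog n u -> uhomog n v -> uhomog n (u + v).
Proof. by move=> hu hv; rewrite -[u]scale1r; apply: uhomogP. Qed.
Lemma uhomogZ n a u : uhomog n u -> uhomog n (a *: u).
Proof. by move=> hu; rewrite -[_ *: _]addr0; apply: uhomogP => //; exact: uhomog0. Qed.
Lemma uhomog_sum n (I : Type) (r : seq I) (P : pred I) (F : I -> U L) :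
  (forall i, P i -> uhomog n (F i)) -> uhomog n (\sum_(i <- r | P i) F i).
Proof.
move=> h; elim/big_ind: _ => //; first exact: uhomog0.
exact: uhomogD.
Qed.
Lemma uhomogMM m n u v : uhomog m u -> uhomog n v -> uhomog (m + n) (u * v).
Proof.
move=> + hv; elim=> {m u}.
- by rewrite mul1r.
- by move=> m; rewrite mul0r; exact: uhomog0.
- by move=> m a u w _ hu _ hw; rewrite mulrDl -scalerAl; exact: uhomogP.
- by move=> i j x u _ hu; rewrite -mulrA -addnA; exact: uhomogM.
Qed.
Lemma uhomog_iota i (x : L i) : uhomog i (iota x).
Proof. by have := uhomogM x (@uhomog1 k L); rewrite mulr1 addn0. Qed.

Lemma ucomp_homog n u : uhomog n (ucomp n u).
Proof.
rewrite /ucomp -(ureprK u).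
elim: (urepr u) n => [c|i x|t IHt t' IHt'|t IHt t' IHt'] n.
- rewrite upiC ugrC coefC; case: eqP => [->|_]; last exact: uhomog0.
  by apply: uhomogZ; exact: uhomog1.
- rewrite -/(iota x) ugr_iota coefCM coefXn; case: eqP => [->|_].
    by rewrite mulr1; exact: uhomog_iota.
  by rewrite mulr0; exact: uhomog0.
- by rewrite upiD ugrD coefD; exact: uhomogD.
- rewrite upiM ugrM coefM; apply: uhomog_sum => i _.
  by rewrite -[X in uhomog X _](subnKC (leq_ord i)); exact: uhomogMM.
Qed.

Lemma ucomp_sum u : u = \sum_(n < size (ugr u)) ucomp n u.
Proof.
rewrite -[LHS]ureprK.
transitivity (ugr u).[1]; last first.
  by rewrite horner_coef; apply: eq_bigr => i _; rewrite expr1n mulr1.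
rewrite -[u in RHS]ureprK.
elim: (urepr u) => [c|i x|t IHt t' IHt'|t IHt t' IHt'].
- by rewrite upiC ugrC hornerC.
- by rewrite -/(iota x) ugr_iota hornerCM hornerXn expr1n mulr1.
- by rewrite upiD ugrD hornerD -IHt -IHt'.
- rewrite upiM ugrM hornerM_comm -?IHt -?IHt' //.
  by rewrite /comm_poly mulr1 mul1r.
Qed.

Lemma gcommE i j u v : uhomog i u -> uhomog j v ->
  gcomm u v = u * v - (-1) ^+ (i * j) *: (v * u).
Proof.
move=> hu hv.
have big (n : nat) w (F : nat -> U L -> U L) : uhomog n w ->
    (forall m, F m 0 = 0) -> \sum_(m < size (ugr w)) F m (ucomp m w) = F n w.
  move=> hw F0; have Ew := ucomp_id hw.
  have [lt|ge] := ltnP n (size (ugr w)).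
    rewrite (bigD1 (Ordinal lt)) //= Ew eqxx big1 ?addr0 // => m.
    by rewrite -val_eqE /= Ew => /negPf->.
  have -> : w = 0 by have := Ew n; rewrite eqxx /ucomp nth_default.
  by rewrite F0 big1 // => m _; rewrite (ucomp_id (uhomog0 L n)) if_same F0.
rewrite /gcomm.
rewrite (big i u (fun m x => \sum_(l < size (ugr v))
   (x * ucomp l v - (-1) ^+ (m * l) *: (ucomp l v * x)))) //.
  rewrite (big j v (fun l y => u * y - (-1) ^+ (i * l) *: (y * u))) //.
  by move=> m; rewrite mulr0 mul0r scaler0 subr0.
by move=> m; rewrite big1 // => l _; rewrite mulr0 mul0r scaler0 subr0.
Qed.

End UGrading.

Definition radicalLie (k : fieldType) (L : gradedLie k) : gradedLie k :=
  subLie (@radical_subalgebra k L).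

Definition iota_radical (k : fieldType) (L : gradedLie k) (i : nat)
    (x : radicalLie L i) : U L :=
  iota (vsval (x : subvs_of (radical L i))).

Lemma iota_radical_morphism (k : fieldType) (L : gradedLie k) :
  lie_morphism (@iota_radical k L).
Proof.
split=> [i a x y|i j n e x y]; rewrite /iota_radical.
  by rewrite linearP iota_linear.
by rewrite vsprojK ?iota_br // radical_subalgebra ?subvsP.
Qed.

(** U(R(L)), seen in U L as its image under the morphism induced by the
  inclusion of R(L). *)
Definition UR (k : fieldType) (L : gradedLie k) : set (U L) :=
  range (ulift (@iota_radical k L)).
Arguments UR {k} L.

(* Main.v *)
(** For a solvable ideal V of L, filter UL by the subspaces W_p spanned by the
  words in which fewer than p letters lie outside V, so that W_1 is the
  subalgebra generated by V.  For w in L_j and a functional h on L_{m+j} that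
  kills V, contracting the coproduct of UL with the matrix coefficient
  h(ad(-) w) of the adjoint representation gives an operator D on UL that lowers
  p by one and is, modulo lower terms, a derivation whose value on x in L_m is
  the scalar h([x, w]), up to sign; call this functional on L_m the symbol of D.

  Let z in W_{p+1} be central of degree n, with p > 0.  The commutator of ad a
  and D is again such an operator, so the common kernel Y of the symbols of those
  D for which D z is smaller than expected is an ideal containing V.  In degrees
  m > n every D kills z, hence [L, Y_m] is contained in V and Y is solvable.  If
  V is maximal in degrees <= n, then Y = V in these degrees.  So there are enough
  D to form an Euler operator E = sum_r y_r D_r with E z in W_p, while
  E z = p z modulo W_p; hence z is in W_p.  Descending, z is in W_1.  No
  Poincare-Birkhoff-Witt theorem is needed. *)

From HB Require Import structures.
Require Import Defs.
From mathcomp Require Import all_boot all_order all_algebra.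
From mathcomp Require Import boolp classical_sets.
From mathcomp Require Import zify.

Set Implicit Arguments.
Unset Strict Implicit.
Unset Printing Implicit Defensive.

Import GRing.Theory.
Local Open Scope ring_scope.
Local Open Scope classical_set_scope.

Local Notation iota := Defs.iota.

(** * Signs, and brackets with zero *)

Lemma sign_eq (R : pzRingType) m n : odd m = odd n -> (-1) ^+ m = (-1) ^+ n :> R.
Proof. by move=> e; rewrite -signr_odd e signr_odd. Qed.

Section Bracket.
Context (k : fieldType) (L : gradedLie k).

Lemma br0l i j n (e : (i + j)%N = n) (y : L j) : br e (0 : L i) y = 0.
Proof.
by have := br_linearl e y (-1) 0 0; rewrite scaler0 addr0 scaleN1r addNr.
Qed.

Lemma br0r i j n (e : (i + j)%N = n) (x : L i) : br e x (0 : L j) = 0.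
Proof.
by have := br_linearr e x (-1) 0 0; rewrite scaler0 addr0 scaleN1r addNr.
Qed.

Lemma iota0 i : iota (0 : L i) = 0.
Proof.
by have := iota_linear (-1) (0 : L i) 0; rewrite scaler0 addr0 scaleN1r addNr.
Qed.

End Bracket.

Ltac parity := rewrite ?(oddD, oddM) /=;
  repeat match goal with |- context [odd ?n] => case: (odd n) end; by [].

(** * A right action of UL on maps from L to UL *)

Section RightAction.
Context (k : fieldType) (L : gradedLie k) (j : nat).

Definition cochain := forall s, L s -> U L.
Implicit Types (t : uterm L) (b : cochain).

(** The right UL-module Hom(L, UL), with
    (b x)(w) = b([x, w]) + (-1)^{is} b(w) x      (x in L_i, w in L_s),
  twisted by the automorphism x |-> (-1)^{ij} x of UL; this twist makes
  [contr j h - j w] below a left derivation without extra signs. *)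
Fixpoint act t b : cochain :=
  match t with
  | UConst c => fun s w => c *: b s w
  | UGen i x => fun s w => (-1) ^+ (i * j) *: b (i + s)%N (br erefl x w)
                         + (-1) ^+ (i * (s + j)) *: (b s w * iota x)
  | UAdd t u => fun s w => @act t b s w + @act u b s w
  | UMul t u => act u (act t b)
  end.

Arguments act t b s w : clear implicits.

Definition hlinear b : Prop :=
  forall s a w w', b s (a *: w + w') = a *: b s w + b s w'.

Lemma hlinear0 b s : hlinear b -> b s 0 = 0.
Proof.
by move=> /(_ s (-1) 0 0); rewrite scaler0 addr0 scaleN1r addNr.
Qed.

Lemma act_linear t b : hlinear b -> hlinear (act t b).
Proof.
elim: t b => [c|i x|t IHt u IHu|t IHt u IHu] b bl s a w w' /=.
- by rewrite bl scalerDr !scalerA mulrC.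
- rewrite br_linearr !bl mulrDl !scalerDr -!scalerAl !scalerA.
  by rewrite -!(mulrC a) addrACA.
- by rewrite (IHt _ bl) (IHu _ bl) scalerDr addrACA.
- by apply: IHu; apply: IHt.
Qed.

Lemma cochainP b b' : (forall s w, b s w = b' s w) -> b = b'.
Proof.
by move=> e; apply/functional_extensionality_dep => s; apply/funext => w.
Qed.

(** [act] multiplies the values of a cochain on the right only, so it commutes with left
    multiplication by [a]. *)
Lemma act_comb t a b b' :
  act t (fun s w => a * b s w + b' s w) =
  fun s w => a * act t b s w + act t b' s w.
Proof.
elim: t b b' => [c|i x|t IHt u IHu|t IHt u IHu] b b' /=.
- apply: cochainP => s w.
  by rewrite scalerDr scalerAr.
- apply: cochainP => s w.
  by rewrite mulrDl mulrDr !scalerDr -!scalerAr mulrA addrACA.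
- apply: cochainP => s w.
  by rewrite IHt IHu mulrDr addrACA.
- by rewrite IHt IHu.
Qed.

Lemma act_add t b b' :
  act t (fun s w => b s w + b' s w) = fun s w => act t b s w + act t b' s w.
Proof.
transitivity (act t (fun s w => 1 * b s w + b' s w)).
  by congr act; apply: cochainP => s w; rewrite mul1r.
by rewrite act_comb; apply: cochainP => s w; rewrite mul1r.
Qed.

Lemma act0 t : act t (fun _ _ => 0) = fun _ _ => 0.
Proof.
transitivity (act t (fun s w => (- 1) * (0 : U L) + 0)).
  by congr act; apply: cochainP => s w; rewrite mulr0 addr0.
rewrite (act_comb t (-1) (fun _ _ => 0) (fun _ _ => 0)).
by apply: cochainP => s w; rewrite mulN1r addNr.
Qed.

Lemma act_scale t c b :
  act t (fun s w => c *: b s w) = fun s w => c *: act t b s w.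
Proof.
transitivity (act t (fun s w => c%:A * b s w + 0)).
  by congr act; apply: cochainP => s w; rewrite mulr_algl addr0.
rewrite (act_comb _ _ b (fun _ _ => 0)) act0.
by apply: cochainP => s w; rewrite mulr_algl addr0.
Qed.

Lemma act_gen i (x : L i) b s w n (e : (i + s)%N = n) :
  act (UGen x) b s w = (-1) ^+ (i * j) *: b n (br e x w)
                     + (-1) ^+ (i * (s + j)) *: (b s w * iota x).
Proof. by case: n / e. Qed.

Lemma act_br i i' n (e : (i + i')%N = n) (x : L i) (y : L i') b :
  hlinear b ->
  act (UGen (br e x y)) b =
  fun s w => act (UMul (UGen x) (UGen y)) b s w -
             (-1) ^+ (i * i') *: act (UMul (UGen y) (UGen x)) b s w.
Proof.
move=> bl; apply: cochainP => s w.
have b0 r := hlinear0 r bl.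
have bZ r c (v : L r) : b r (c *: v) = c *: b r v.
  by have := bl r c v 0; rewrite b0 !addr0.
have bB r (v v' : L r) : b r (v - v') = b r v - b r v'.
  by have := bl r (-1) v' v; rewrite !scaleN1r ![- _ + _]addrC.
have e2 : (n + s = i + (i' + s))%N by rewrite -e addnA.
have e3 : (n + s = i' + (i + s))%N by rewrite e2 !addnA (addnC i).
have actM r r' (u : L r) (v : L r') : act (UMul (UGen u) (UGen v)) b s w =
    (-1) ^+ (r' * j) *: act (UGen u) b (r' + s)%N (br erefl v w)
    + (-1) ^+ (r' * (s + j)) *: (act (UGen u) b s w * iota v) by [].
rewrite !actM (act_gen _ _ _ (esym e2)) (act_gen _ _ _ (esym e3)).
rewrite !(act_gen _ _ _ erefl).
have -> : br (erefl (n + s)%N) (br e x y) w =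
    br (esym e2) x (br (erefl (i' + s)%N) y w)
    - (-1) ^+ (i * i') *: br (esym e3) y (br (erefl (i + s)%N) x w).
  rewrite (br_jacobi e (erefl _) (erefl (i + s)%N) (esym e2) (erefl _) (esym e3)).
  by rewrite addrK.
rewrite bB bZ iota_br.
set b1 := b _ _; set b2 := b _ _; set b4 := b (i' + s)%N _.
set b6 := b (i + s)%N _.
rewrite !(scalerDr, mulrDl, mulrDr, scalerN, mulrN, mulNr, opprD) -?scalerAl.
rewrite -?scalerAr !mulrA !scalerA -!exprD.
(* Signs: [s1] and [s2] for double brackets, [s3] and [s4] for double products, [s5] and [s6] for
   the cancelling mixed pairs. *)
have s1 : odd (i' * j + i * j) = odd (n * j).
  by rewrite -e; parity.
have s2 : odd (i * i' + i * j + i' * j) = odd (n * j + i * i').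
  by rewrite -e; parity.
have s3 : odd (i' * (s + j) + i * (s + j)) = odd (n * (s + j)).
  by rewrite -e; parity.
have s4 : odd (i * i' + i * (s + j) + i' * (s + j)) = odd (n * (s + j) + i * i').
  by rewrite -e; parity.
have s5 : odd (i * i' + i * (s + j) + i' * j) = odd (i' * j + i * (i' + s + j)).
  by parity.
have s6 : odd (i * i' + i * j + i' * (i + s + j)) = odd (i' * (s + j) + i * j).
  by parity.
rewrite (sign_eq _ s1) (sign_eq _ s2) (sign_eq _ s3) (sign_eq _ s4).
rewrite (sign_eq _ s5) (sign_eq _ s6).
rewrite [RHS](AC (2*2*(2*2)) (1*5*(4*8)*((2*7)*(3*6)))) /=.
by rewrite !subrr !addr0.
Qed.

Lemma act_cong t u b : ucong t u -> hlinear b -> act t b = act u b.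
Proof.
move=> tu; elim: tu b => {t u}.
- by [].
- by move=> t u _ IH b bl /=; rewrite IH.
- by move=> t u v _ IH1 _ IH2 b bl /=; rewrite IH1 ?IH2.
- by move=> t t' u u' _ IH1 _ IH2 b bl /=; rewrite IH1 ?IH2.
- by move=> t t' u u' _ IH1 _ IH2 b bl /=; rewrite IH1 ?IH2 //; exact: act_linear.
- by move=> t u v b bl; apply: cochainP => s w /=; rewrite addrA.
- by move=> t u b bl; apply: cochainP => s w /=; rewrite addrC.
- by move=> t b bl; apply: cochainP => s w /=; rewrite scale0r add0r.
- by [].
- move=> t b bl /=; rewrite act_scale.
  by apply: cochainP => s w /=; rewrite !scale0r.
- move=> t b bl /=; congr act.
  by apply: cochainP => s w /=; rewrite scale1r.
- by move=> t u v b bl /=; rewrite act_add.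
- by [].
- by move=> c d b bl; apply: cochainP => s w /=; rewrite scalerDl.
- by move=> c d b bl; apply: cochainP => s w /=; rewrite scalerA mulrC.
- by move=> c t b bl /=; rewrite act_scale.
- move=> i c x y b bl; apply: cochainP => s w /=; rewrite br_linearl bl iota_linear.
  rewrite mulrDr !scalerDr -scalerAr !scalerA -!(mulrC c).
  by rewrite -scalerAl scalerA [_ * c]mulrC addrACA.
- move=> i i' n e x y b bl; rewrite act_br //.
  pose c : k := - (-1) ^+ (i * i').
  have -> : act (UAdd (UMul (UGen x) (UGen y))
                   (UMul (UConst c) (UMul (UGen y) (UGen x)))) b =
      fun s w => act (UMul (UGen x) (UGen y)) b s w +
        act (UMul (UGen y) (UGen x)) (fun r v => c *: b r v) s w by [].
  by rewrite act_scale; apply: cochainP => s w /=; rewrite scaleNr.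
Qed.

Lemma act_support t b r : (forall s w, (r < s)%N -> b s w = 0) ->
  forall s w, (r < s)%N -> act t b s w = 0.
Proof.
elim: t b => [c|i x|t IHt u IHu|t IHt u IHu] b b0 s w rs /=.
- by rewrite b0 ?scaler0.
- by rewrite !b0 ?mul0r ?scaler0 ?addr0 //; apply: leq_trans rs (leq_addl _ _).
- by rewrite IHt ?IHu ?addr0.
- by apply: (IHu (act t b)) => // s' w' rs'; exact: IHt.
Qed.

(** For w of degree j and x nonzero, [x, w] lies above degree j, where [b] vanishes, so only right
    multiplication remains; the twist makes its sign (-1)^{i(j+j)} = 1. *)
Lemma act_top t b w : hlinear b -> (forall s w, (j < s)%N -> b s w = 0) ->
  act t b j w = b j w * upi t.
Proof.
elim: t b => [c|i x|t IHt u IHu|t IHt u IHu] b bl b0 /=.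
- by rewrite upiC mulr_algr.
- have -> : b (i + j)%N (br erefl x w) = 0.
    case: i x => [|i] x; last by rewrite b0 // addSn ltnS leq_addl.
    by rewrite [x]lie_comp0 br0l; exact: hlinear0.
  rewrite scaler0 add0r (@sign_eq _ _ 0) ?expr0 ?scale1r //.
  by parity.
- by rewrite IHt ?IHu // upiD mulrDr.
- rewrite (IHu (act t b)) ?IHt ?upiM ?mulrA //; first exact: act_linear.
  exact: act_support.
Qed.

End RightAction.

(** * Contraction of UL against a functional on L *)

Section Contraction.
Context (k : fieldType) (L : gradedLie k) (j : nat).

Definition functional := forall s, L s -> k.
Implicit Types (h : functional) (u v : U L).

Definition klinear h : Prop :=
  forall s a w w', h s (a *: w + w') = a * h s w + h s w'.

Definition coef h : cochain L := fun s w => (h s w)%:A.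
Arguments coef h s w : clear implicits.

(** Each letter of a word of [u] is either absorbed, acting on [w] by ad inside [h], or survives.
    This is the coproduct of [u] contracted with the matrix coefficient h(ad(-) w). *)
Definition contr h u : cochain L := act j (urepr u) (coef h).
Arguments contr h u s w : clear implicits.

Definition adf i (x : L i) h : functional :=
  fun s w => (-1) ^+ (i * j) * h (i + s)%N (br erefl x w).

Definition twf i h : functional := fun s w => (-1) ^+ (i * (s + j)) * h s w.

Lemma coef_linear h : klinear h -> hlinear (coef h).
Proof. by move=> hl s a w w'; rewrite /coef hl scalerDl scalerA. Qed.

Lemma adf_linear i (x : L i) h : klinear h -> klinear (adf x h).
Proof.
by move=> hl s a w w'; rewrite /adf br_linearr hl mulrDr !mulrA (mulrC a).
Qed.

Lemma twf_linear i h : klinear h -> klinear (twf i h).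
Proof. by move=> hl s a w w'; rewrite /twf hl mulrDr !mulrA (mulrC a). Qed.

Lemma contr_pi h t : klinear h -> contr h (upi t) = act j t (coef h).
Proof. by move=> hl; apply: act_cong (urepr_pi t) (coef_linear hl). Qed.

Lemma contrP h a u v s w : klinear h ->
  contr h (a *: u + v) s w = a *: contr h u s w + contr h v s w.
Proof.
move=> hl; rewrite -(ureprK u) -(ureprK v) -mulr_algl -upiC -upiM -upiD.
by rewrite !contr_pi //= act_scale.
Qed.

Lemma contr0r h s w : klinear h -> contr h 0 s w = 0.
Proof.
by move=> /(contrP (-1) 0 0 w); rewrite scaler0 addr0 scaleN1r addNr.
Qed.

Lemma contr1 h s w : klinear h -> contr h 1 s w = (h s w)%:A.
Proof. by move=> hl; rewrite -(scale1r 1) -upiC contr_pi //= scale1r. Qed.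

(** The first letter is absorbed by the functional ([adf]) or survives ([twf]). In the second case
    it multiplies scalars, so it can be moved to the left, where [act_comb] carries it through. *)
Lemma contrM h i (x : L i) u s w : klinear h ->
  contr h (iota x * u) s w =
  contr (adf x h) u s w + iota x * contr (twf i h) u s w.
Proof.
move=> hl; rewrite -(ureprK u) /iota -upiM !contr_pi //; last 2 first.
- exact: twf_linear.
- exact: adf_linear.
rewrite -/(iota x).
have -> : act j (UMul (UGen x) (urepr u)) (coef h) = act j (urepr u)
    (fun s w => iota x * coef (twf i h) s w + coef (adf x h) s w).
  transitivity (act j (urepr u) (act j (UGen x) (coef h))) => //.
  congr act; apply: cochainP => s' w'.
  by rewrite /= /coef /twf /adf mulr_algr mulr_algl !scalerA addrC.
by rewrite act_comb addrC.
Qed.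

Lemma contr_top h u w : klinear h -> (forall s w, (j < s)%N -> h s w = 0) ->
  contr h u j w = h j w *: u.
Proof.
move=> hl h0; rewrite -{1}(ureprK u) contr_pi // act_top; last 2 first.
- exact: coef_linear.
- by move=> s v js; rewrite /coef h0 // scale0r.
by rewrite ureprK mulr_algl.
Qed.

Lemma contr_support h u r : klinear h -> (forall s w, (r < s)%N -> h s w = 0) ->
  forall s w, (r < s)%N -> contr h u s w = 0.
Proof.
move=> hl h0 s w rs; apply: act_support rs => s' w' rs'.
by rewrite /coef h0 // scale0r.
Qed.

End Contraction.
Arguments coef {k L} h s w.
Arguments contr {k L} j h u s w.
Arguments adf {k L} j {i} x h s w.
Arguments twf {k L} j i h s w.

Lemma iota_swap (k : fieldType) (L : gradedLie k) i j (x : L i) (y : L j) :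
  iota x * iota y =
  iota (br erefl x y) + (-1) ^+ (i * j) *: (iota y * iota x).
Proof. by rewrite iota_br subrK. Qed.

(** * The operators ad a on UL *)

Section Ad.
Context (k : fieldType) (L : gradedLie k) (l : nat) (a : L l).
Implicit Types u v : U L.

(** Here [d] is the degree that [u] is meant to have; [u] need not be homogeneous. *)
Definition uad d u : U L := iota a * u - (-1) ^+ (l * d) *: (u * iota a).

Lemma uadP d c u v : uad d (c *: u + v) = c *: uad d u + uad d v.
Proof.
rewrite /uad mulrDr mulrDl scalerDr opprD addrACA -scalerAr -scalerAl.
by rewrite scalerA mulrC -scalerA -scalerBr.
Qed.

Lemma uad0 d : uad d 0 = 0.
Proof. by rewrite /uad mulr0 mul0r scaler0 subrr. Qed.

Lemma uadM d i (x : L i) u : uad (i + d) (iota x * u) =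
  iota (br erefl a x) * u + (-1) ^+ (l * i) *: (iota x * uad d u).
Proof.
rewrite /uad mulrA iota_swap mulrDl -addrA -scalerAl -!mulrA; congr (_ + _).
by rewrite mulrBr scalerBr -!scalerAr scalerA -exprD -mulnDr.
Qed.

Lemma uad_odd d d' u : odd d = odd d' -> uad d u = uad d' u.
Proof. by move=> e; rewrite /uad (@sign_eq _ _ (l * d')) // !oddM e. Qed.

End Ad.

(** * Filtration of UL by the number of letters outside V *)

Section Weight.
Context (k : fieldType) (L : gradedLie k) (V : graded_subspace L).
Context (Vi : lie_ideal V).
Implicit Types u v : U L.

(** [wt p d] is the span of the words of degree [d] with fewer than [p] letters
  outside [V]; in particular [wt 0 d] is zero. *)
Inductive wt : nat -> nat -> U L -> Prop :=
  | wt0 p d : wt p d 0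
  | wt1 p : wt p.+1 0 1
  | wtP p d a u v : wt p d u -> wt p d v -> wt p d (a *: u + v)
  | wtV p d i (x : L i) u : x \in V i -> wt p d u -> wt p (i + d) (iota x * u)
  | wtL p d i (x : L i) u : wt p d u -> wt p.+1 (i + d) (iota x * u).

Lemma wt_nil p d u : wt p d u -> p = 0%N -> u = 0.
Proof.
elim=> {p d u} // [p d a u v _ IHu _ IHv|p d i x u _ _ IHu] p0.
- by rewrite IHu ?IHv // scaler0 addr0.
- by rewrite IHu ?mulr0.
Qed.

Lemma wtZ p d a u : wt p d u -> wt p d (a *: u).
Proof. by move=> hu; rewrite -[_ *: _]addr0; apply: wtP hu (wt0 _ _). Qed.

Lemma wtD p d u v : wt p d u -> wt p d v -> wt p d (u + v).
Proof. by move=> hu hv; rewrite -[u]scale1r; apply: wtP. Qed.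

Lemma wtN p d u : wt p d u -> wt p d (- u).
Proof. by move=> hu; rewrite -scaleN1r; apply: wtZ. Qed.

Lemma wtB p d u v : wt p d u -> wt p d v -> wt p d (u - v).
Proof. by move=> hu /wtN; apply: wtD. Qed.

Lemma wt_leS p d u : wt p d u -> wt p.+1 d u.
Proof.
elim=> {p d u} [p d|p|p d a u v _ hu _ hv|p d i x u xV _ hu|p d i x u _ hu].
- exact: wt0.
- exact: wt1.
- exact: wtP.
- exact: wtV.
- exact: wtL.
Qed.

Lemma wt_homog d u : uhomog d u -> exists p, wt p d u.
Proof.
elim=> {d u} [|d|d a u v _ [p hu] _ [q hv]|i j x u _ [q hu]].
- by exists 1%N; exact: wt1.
- by exists 0%N; exact: wt0.
- exists (p + q)%N; apply: wtP.
    by elim: q {hv} => [|q IH]; rewrite ?addn0 ?addnS //; exact: wt_leS.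
  by elim: p {hu} => [|p' IH]; rewrite ?add0n ?addSn //; exact: wt_leS.
- by exists q.+1; exact: wtL.
Qed.

Lemma wt_ad p d l (a : L l) u : wt p d u -> wt p (l + d) (uad a d u).
Proof.
elim=> {p d u}.
- by move=> p d; rewrite uad0; exact: wt0.
- by move=> p; rewrite /uad muln0 scale1r mulr1 mul1r subrr; exact: wt0.
- by move=> p d c u v _ IHu _ IHv; rewrite uadP; exact: wtP.
- move=> p d i x u xV hu IH; rewrite uadM; apply: wtD.
    by rewrite addnA; apply: wtV => //; exact: Vi.
  by apply: wtZ; rewrite addnCA; exact: wtV.
- move=> p d i x u hu IH; rewrite uadM; apply: wtD.
    by rewrite addnA; apply: wtL.
  by apply: wtZ; rewrite addnCA; exact: wtL.
Qed.

(** Membership in [wt p (d - m)], where a negative degree means zero. *)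
Definition wtd m p d u : Prop :=
  (forall e, d = (m + e)%N -> wt p e u) /\ ((d < m)%N -> u = 0).

Lemma wtd0 m p d : wtd m p d 0.
Proof. by split=> // e _; exact: wt0. Qed.

Lemma wtdP m p d a u v : wtd m p d u -> wtd m p d v -> wtd m p d (a *: u + v).
Proof.
move=> [u1 u0] [v1 v0]; split=> [e de|dm]; first by apply: wtP; auto.
by rewrite u0 ?v0 // scaler0 addr0.
Qed.

Lemma wtdZ m p d a u : wtd m p d u -> wtd m p d (a *: u).
Proof. by move=> hu; rewrite -[_ *: _]addr0; apply: wtdP hu (wtd0 _ _ _). Qed.

Lemma wtdD m p d u v : wtd m p d u -> wtd m p d v -> wtd m p d (u + v).
Proof. by move=> hu hv; rewrite -[u]scale1r; apply: wtdP. Qed.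

Lemma wtdN m p d u : wtd m p d u -> wtd m p d (- u).
Proof. by move=> hu; rewrite -scaleN1r; apply: wtdZ. Qed.

Lemma wtdB m p d u v : wtd m p d u -> wtd m p d v -> wtd m p d (u - v).
Proof. by move=> hu /wtdN; apply: wtdD. Qed.

Lemma wtd_leS m p d u : wtd m p d u -> wtd m p.+1 d u.
Proof. by move=> [u1 u0]; split=> // e de; apply: wt_leS; auto. Qed.

Lemma wtd_case m p d u : wtd m p d u ->
  u = 0 \/ exists2 e, d = (m + e)%N & wt p e u.
Proof.
move=> [u1 u0]; case: (leqP m d) => [md|dm]; last by left; auto.
right; exists (d - m)%N; first by rewrite subnKC.
by apply: u1; rewrite subnKC.
Qed.

Lemma wtd_exact m p e u : wt p e u -> wtd m p (m + e) u.
Proof. by move=> hu; split=> [e' /addnI <-|] //; rewrite ltnNge leq_addr. Qed.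

Lemma wtdV m p d i (x : L i) u : x \in V i -> wtd m p d u ->
  wtd m p (i + d) (iota x * u).
Proof.
move=> xV /wtd_case [->|[e -> hu]]; first by rewrite mulr0; exact: wtd0.
by rewrite addnCA; apply: wtd_exact; exact: wtV.
Qed.

Lemma wtdL m p d i (x : L i) u : wtd m p d u ->
  wtd m p.+1 (i + d) (iota x * u).
Proof.
move=> /wtd_case [->|[e -> hu]]; first by rewrite mulr0; exact: wtd0.
by rewrite addnCA; apply: wtd_exact; exact: wtL.
Qed.

Lemma wtd_shift i r p s d u : wtd r p (s + d) u -> wtd (i + r) p (s + (i + d)) u.
Proof.
move=> [u1 u0]; split=> [e E|lt]; [apply: u1|apply: u0]; lia.
Qed.

Lemma wtd_unshift j m p d u : wtd (m + j) p (j + d) u -> wtd m p d u.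
Proof.
move=> [u1 u0]; split=> [e E|lt]; [apply: u1|apply: u0]; lia.
Qed.

Lemma wtdK m p d (y : L m) u : wtd m p d u -> wt p.+1 d (iota y * u).
Proof.
move=> /wtd_case [->|[e -> hu]]; first by rewrite mulr0; exact: wt0.
exact: wtL.
Qed.

Lemma wtdKV m p d i (y : L (i + m)) u : y \in V (i + m)%N -> wtd m p d u ->
  wt p (i + d) (iota y * u).
Proof.
move=> yV /wtd_case [->|[e -> hu]]; first by rewrite mulr0; exact: wt0.
by rewrite addnA; exact: wtV.
Qed.

Lemma wtdKL m p d i (y : L (i + m)) u : wtd m p d u ->
  wt p.+1 (i + d) (iota y * u).
Proof.
move=> /wtd_case [->|[e -> hu]]; first by rewrite mulr0; exact: wt0.
by rewrite addnA; exact: wtL.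
Qed.

(** The element has degree [d - (l + m)]; [d + (l + m)] has the same parity, hence gives the same
    sign without a subtraction. *)
Lemma wtd_ad m p d l (a : L l) u : wtd (l + m) p d u ->
  wtd m p d (uad a (d + (l + m)) u).
Proof.
move=> /wtd_case [->|[e -> hu]]; first by rewrite uad0; exact: wtd0.
rewrite (@uad_odd _ _ _ _ _ e); last by parity.
by rewrite -addnA addnCA; apply: wtd_exact; exact: wt_ad.
Qed.

End Weight.

(** * Contractions and the filtration *)

Section ContrWeight.
Context (k : fieldType) (L : gradedLie k) (V : graded_subspace L).
Context (Vi : lie_ideal V) (j : nat).
Implicit Types (u v : U L) (h : functional L).

Lemma ideal_brl i l n (e : (i + l)%N = n) (x : L i) (y : L l) :
  x \in V i -> br e x y \in V n.
Proof.
move=> xV; have e' : (l + i)%N = n by rewrite addnC.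
by rewrite (br_anti e e') rpredN rpredZ //; exact: Vi.
Qed.

Definition kills h : Prop := forall s w, w \in V s -> h s w = 0.

Definition supported h r : Prop := forall s w, s <> r -> h s w = 0.

Lemma adf_kills i (x : L i) h : kills h -> kills (adf j x h).
Proof. by move=> hV s w wV; rewrite /adf hV ?mulr0 //; exact: Vi. Qed.

Lemma twf_kills i h : kills h -> kills (twf j i h).
Proof. by move=> hV s w wV; rewrite /twf hV ?mulr0. Qed.

Lemma twf_supported i h r : supported h r -> supported (twf j i h) r.
Proof. by move=> hr s w sr; rewrite /twf hr ?mulr0. Qed.

Lemma adf_supported i (x : L i) h r :
  supported h (i + r) -> supported (adf j x h) r.
Proof. by move=> hr s w sr; rewrite /adf hr ?mulr0 // => /addnI. Qed.

Lemma adf_support_lt i (x : L i) h r : supported h r -> (r < i)%N ->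
  forall s w, adf j x h s w = 0.
Proof. by move=> hr ri s w; rewrite /adf hr ?mulr0 // => E; lia. Qed.

Lemma adf_V i (x : L i) h : x \in V i -> kills h ->
  forall s w, adf j x h s w = 0.
Proof. by move=> xV hV s w; rewrite /adf hV ?mulr0 //; exact: ideal_brl. Qed.

Lemma contr0 h u s w : (forall s w, h s w = 0) -> contr j h u s w = 0.
Proof.
move=> h0; rewrite /contr (_ : coef h = fun _ _ => 0) ?act0 //.
by apply: cochainP => s' w'; rewrite /coef h0 scale0r.
Qed.

(** The absorbed letters have total degree [r - s], whence the degree [s + d - r] of the result. A
    letter of V cannot be absorbed, as [h] kills the ideal V. *)
Lemma contr_wtd p d u h r s w : klinear h -> kills h -> supported h r ->
  wt V p d u -> wtd V r p (s + d) (contr j h u s w).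
Proof.
move=> hl hV hr hu; elim: hu h r s w hl hV hr => {p d u}.
- move=> p d h r s w hl hV hr.
  by rewrite contr0r //; exact: wtd0.
- move=> p h r s w hl hV hr; rewrite contr1 //.
  case: (eqVneq s r) hr => [<-|/eqP sr] hr; last by rewrite hr // scale0r; exact: wtd0.
  by apply: wtd_exact; apply: wtZ; exact: wt1.
- move=> p d a u v _ IHu _ IHv h r s w hl hV hr.
  by rewrite contrP //; apply: wtdP; auto.
- move=> p d i x u xV hu IH h r s w hl hV hr; rewrite contrM //.
  rewrite contr0 ?add0r; last exact: adf_V.
  rewrite addnCA; apply: wtdV => //; apply: IH.
  + exact: twf_linear.
  + exact: twf_kills.
  + exact: twf_supported.
- move=> p d i x u hu IH h r s w hl hV hr; rewrite contrM //; apply: wtdD.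
    case: (leqP i r) => [ir|ri]; last first.
      by rewrite contr0; [exact: wtd0|exact: adf_support_lt ri].
    rewrite -(subnKC ir); apply: wtd_shift; apply: wtd_leS; apply: IH.
    + exact: adf_linear.
    + exact: adf_kills.
    + by apply: adf_supported; rewrite subnKC.
  rewrite addnCA; apply: wtdL; apply: IH.
  + exact: twf_linear.
  + exact: twf_kills.
  + exact: twf_supported.
Qed.

(** As [h] vanishes in degree [s < r], at least one letter must be absorbed, and it lies outside
    V. *)
Lemma contr_wtd_lt p d u h r s w : klinear h -> kills h -> supported h r ->
  (s < r)%N -> wt V p d u -> wtd V r p.-1 (s + d) (contr j h u s w).
Proof.
move=> hl hV hr sr hu; elim: hu h r s w hl hV hr sr => {p d u}.
- move=> p d h r s w hl hV hr sr.
  by rewrite contr0r //; exact: wtd0.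
- move=> p h r s w hl hV hr sr; rewrite contr1 //.
  by rewrite hr ?scale0r; [exact: wtd0|lia].
- move=> p d a u v _ IHu _ IHv h r s w hl hV hr sr.
  by rewrite contrP //; apply: wtdP; auto.
- move=> p d i x u xV hu IH h r s w hl hV hr sr; rewrite contrM //.
  rewrite contr0 ?add0r; last exact: adf_V.
  rewrite addnCA; apply: wtdV => //; apply: IH => //.
  + exact: twf_linear.
  + exact: twf_kills.
  + exact: twf_supported.
- move=> p d i x u hu IH h r s w hl hV hr sr; rewrite contrM //; apply: wtdD.
    case: (leqP i r) => [ir|ri]; last first.
      by rewrite contr0; [exact: wtd0|exact: adf_support_lt ri].
    rewrite -(subnKC ir); apply: wtd_shift; apply: contr_wtd => //.
    + exact: adf_linear.
    + exact: adf_kills.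
    + by apply: adf_supported; rewrite subnKC.
  (* With [p = 0] the truncated [p.-1] would make [wtdL] give a bound one too large, but then
     [u = 0]. *)
  case: p hu IH => [|p] hu IH.
    rewrite (wt_nil hu) // contr0r ?mulr0; first exact: wtd0.
    exact: twf_linear.
  rewrite addnCA; apply: wtdL; apply: IH => //.
  + exact: twf_linear.
  + exact: twf_kills.
  + exact: twf_supported.
Qed.

End ContrWeight.

(** * Derivations modulo lower weight, and their commutators with ad a *)

Section QuasiDerivation.
Context (k : fieldType) (L : gradedLie k) (V : graded_subspace L).
Context (Vi : lie_ideal V).
Implicit Types (u v : U L) (g : functional L) (D : nat -> U L -> U L).

(** The defect in the signed Leibniz rule on x u, for [D] of degree -m with scalar value [g i x] on
    the letter x. *)
Definition qerr m g D i d (x : L i) u : U L :=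
  D (i + d)%N (iota x * u) - g i x *: u - (-1) ^+ (i * m) *: (iota x * D d u).

(** [D d] is the operator on elements of degree [d], so that the signs in [adder]
  need no parity automorphism. *)
Record qder m g D : Prop := Qder {
  qder_klinear : klinear g;
  qder_supported : supported g m;
  qder_kills : kills V g;
  qder_linear : forall d a u v, D d (a *: u + v) = a *: D d u + D d v;
  qder1 : D 0%N 1 = 0;
  qder_deg : forall p d u, wt V p.+1 d u -> wtd V m p d (D d u);
  qderV : forall i d (x : L i) u, x \in V i -> qerr m g D d x u = 0;
  qderL : forall p i d (x : L i) u, wt V p.+1 d u ->
    wtd V m p (i + d) (qerr m g D d x u)
}.

Lemma qder_contr j m (w : L j) h : (0 < m)%N -> klinear h -> kills V h ->
  supported h (m + j) ->
  qder m (fun i x => adf j x h j w) (fun _ u => contr j h u j w).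
Proof.
move=> m0 hl hV hr.
have gs i (x : L i) : i <> m -> adf j x h j w = 0.
  by move=> im; rewrite /adf hr ?mulr0 // => /addIn.
(* On the support s = m + j of [h] the sign (-1)^{i(s+j)} is (-1)^{im}. *)
have twE i u : contr j (twf j i h) u j w =
    (-1) ^+ (i * m) *: contr j h u j w.
  pose c : k := (-1) ^+ (i * m).
  rewrite /contr (_ : coef (twf j i h) = fun s x => c *: coef h s x).
    by rewrite act_scale.
  apply: cochainP => s y; rewrite /coef /twf scalerA.
  case: (eqVneq s (m + j)%N) => [E|/eqP ?]; last by rewrite hr ?mulr0.
  rewrite (@sign_eq _ _ (i * m)) // E; parity.
split=> //.
- move=> i a x x'; rewrite /adf br_linearl hl mulrDr !mulrA (mulrC a) //.
- by move=> i x xV; rewrite (adf_V Vi).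
- by move=> _ a u v; rewrite contrP.
- by rewrite contr1 // hr ?scale0r //; lia.
- move=> p d u hu; apply: (@wtd_unshift _ _ _ j).
  by apply: contr_wtd_lt hu => //; lia.
- move=> i d x u xV; rewrite /qerr contrM // contr0 ?add0r; last exact: (adf_V Vi).
  by rewrite twE -scalerAr (adf_V Vi) // scale0r subr0 subrr.
- move=> p i d x u hu; rewrite /qerr contrM // twE -scalerAr.
  rewrite addrAC addrK.
  (* The error is the contraction with x absorbed, minus the symbol. For i < m the remaining
     functional lives above degree j, so another letter is lost; for i > m it lives below j or is
     zero, and contributes nothing; for i = m it lives in degree j and yields exactly the symbol. *)
  case: (ltngtP i m) => [im|mi|im].
  + rewrite gs ?scale0r ?subr0; last by lia.
    apply: (@wtd_unshift _ _ _ j); rewrite addnA [(j + i)%N]addnC -addnA.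
    have -> : (m + j = i + (m + j - i))%N by lia.
    have := @wtd_shift _ _ V i (m + j - i)%N p j d.
    rewrite (addnCA i); apply; apply: (@contr_wtd_lt _ _ _ Vi _ p.+1); rewrite //; last by lia.
    + exact: adf_linear.
    + exact: (adf_kills Vi).
    + by apply: adf_supported; rewrite subnKC //; lia.
  + rewrite gs ?scale0r ?subr0; last by lia.
    rewrite (_ : contr _ _ _ _ _ = 0); first exact: wtd0.
    case: (leqP i (m + j)) => ij; last first.
      by apply: contr0; exact: (adf_support_lt _ _ hr ij).
    apply: (@contr_support _ _ _ _ _ (m + j - i)%N); last by lia.
      exact: adf_linear.
    move=> s v sv; rewrite /adf hr ?mulr0 //; lia.
  + rewrite contr_top ?subrr; [exact: wtd0|exact: adf_linear|].
    by move=> s v sv; rewrite /adf hr ?mulr0 //; lia.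
Qed.

Section AdQuasiDerivation.
Context (l m : nat) (a : L l) (g : functional L) (D : nat -> U L -> U L).
Context (gD : qder (l + m) g D).

Definition adsym : functional L :=
  fun i x => - (-1) ^+ (l * (l + m)) * @g (l + i)%N (br erefl a x).

(** Up to sign, the graded commutator of [ad a] and [D]. *)
Definition adder d u : U L := uad a (d + (l + m)) (D d u)
  - (-1) ^+ (l * (l + m)) *: D (l + d)%N (uad a d u).

(** [uad a] obeys the Leibniz rule exactly and [D] up to [qerr], so only defects of [D] remain: the
    terms in g(x) (ad a) u and in [a, x] D u cancel. *)
Lemma qerr_ad i d (x : L i) u : qerr m adsym adder d x u =
  uad a (i + d + (l + m)) (qerr (l + m) g D d x u)
  - (-1) ^+ (l * (l + m)) *: qerr (l + m) g D d (br erefl a x) u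
  - (-1) ^+ (l * (l + m) + l * i) *: qerr (l + m) g D (l + d) x (uad a d u).
Proof.
have [gl gs _ Dl _ _ _ _] := gD.
have DD n v v' : D n (v + v') = D n v + D n v'.
  by have := Dl n 1 v v'; rewrite !scale1r.
have D0 n : D n 0 = 0.
  by have := Dl n (-1) 0 0; rewrite scaler0 addr0 scaleN1r addNr.
have DZ n c v : D n (c *: v) = c *: D n v.
  by have := Dl n c v 0; rewrite D0 !addr0.
have aB n v v' : uad a n (v - v') = uad a n v - uad a n v'.
  by have := uadP a n (-1) v' v; rewrite !scaleN1r ![- _ + _]addrC.
have aZ n c v : uad a n (c *: v) = c *: uad a n v.
  by have := uadP a n c v 0; rewrite uad0 !addr0.
(* In the only degree i = l + m where [g] can be nonzero, both nominal degrees have the same parity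
   and the sign is 1. *)
have gE : @g i x *: uad a (i + d + (l + m)) u =
    ((-1) ^+ (l * (l + m) + l * i) * @g i x) *: uad a d u.
  case: (eqVneq i (l + m)%N) => [E|/eqP ne]; last by rewrite gs // mulr0 !scale0r.
  rewrite (@uad_odd _ _ _ _ _ d); last by rewrite E; parity.
  by rewrite (@sign_eq _ _ 0) ?mul1r // E; parity.
rewrite /qerr /adsym /adder uadM DD DZ !aB !aZ gE -(addnA i d) uadM.
rewrite -(addnA l i d) [(i + (l + d))%N]addnCA.
set P := uad a _ (D _ _); set D2 := D (l + (i + d))%N (_ * u).
set D3 := D (l + (i + d))%N _; set W := uad a _ (D d u).
set B := iota (br erefl a x) * _; set g2 := g _; set v := uad a d u.
set W3 := D (l + d)%N v; clearbody P D2 D3 W B W3; clearbody g2 v.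
rewrite mulrBr !(scalerBr, scalerDr) -!scalerAr !scalerA !opprB !opprD.
rewrite !mulNr !scaleNr ?opprK -!exprD.
rewrite (@sign_eq _ (l * (l + m) + (l + i) * (l + m)) (i * (l + m))); last by parity.
rewrite [(-1) ^+ (i * m)](@sign_eq _ _ (i * (l + m) + l * i)); last by parity.
rewrite (@sign_eq _ (l * (l + m) + l * i + i * (l + m)) (i * m + l * (l + m)));
  last by parity.
rewrite [RHS](AC (2*2*(1*2)*(1*2)) (1*(7*10)*6*(8*4)*((9*2)*(5*3)))) /=.
by rewrite !subrr !addr0.
Qed.

Lemma qder_ad : qder m adsym adder.
Proof.
have [gl gs gV Dl D1 Dd eV eL] := gD.
have D0 n : D n 0 = 0.
  by have := Dl n (-1) 0 0; rewrite scaler0 addr0 scaleN1r addNr.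
split.
- by move=> i c x x'; rewrite /adsym br_linearr gl mulrDr !mulrA (mulrC c).
- by move=> i x im; rewrite /adsym gs ?mulr0 // => /addnI.
- by move=> i x xV; rewrite /adsym gV ?mulr0 //; exact: Vi.
- move=> d c u v; rewrite /adder !(Dl, uadP) !scalerDr opprD addrACA scalerN.
  by rewrite !scalerA mulrN1 mulNr scaleNr [_ * c]mulrC.
- rewrite /adder D1 uad0 sub0r /uad muln0 scale1r mulr1 mul1r subrr D0.
  by rewrite scaler0 oppr0.
- move=> p d u hu; apply: wtdB; first by apply: wtd_ad => //; exact: Dd.
  apply: wtdZ; apply: (@wtd_unshift _ _ _ l); rewrite [(m + l)%N]addnC.
  by apply: Dd; exact: wt_ad.
- move=> i d x u xV; rewrite qerr_ad !eV //; last exact: Vi.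
  by rewrite uad0 !scaler0 !subr0.
- move=> p i d x u hu; rewrite qerr_ad; apply: wtdB; first apply: wtdB.
  + by apply: wtd_ad => //; exact: eL.
  + apply: wtdZ; apply: (@wtd_unshift _ _ _ l); rewrite [(m + l)%N]addnC addnA.
    exact: eL.
  + apply: wtdZ; apply: (@wtd_unshift _ _ _ l); rewrite [(m + l)%N]addnC addnCA.
    by apply: eL; exact: wt_ad.
Qed.

End AdQuasiDerivation.

End QuasiDerivation.

(** * Linear functionals on the components of L *)

Section Functionals.
Context (k : fieldType) (L : gradedLie k).
Implicit Type h : functional L.

Lemma klinear_kernel h i : klinear h ->
  exists W : {vspace L i}, forall x, (x \in W) = (h i x == 0).
Proof.
move=> hl.
pose fM := GRing.isLinear.Build k (L i) k^o *:%R (h i) (hl i).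
pose f : {linear L i -> k^o} := HB.pack (h i) fM.
by exists (lker (linfun f)) => x; rewrite memv_ker lfunE.
Qed.

Lemma functional_single r (f : L r -> k) :
  (forall a x y, f (a *: x + y) = a * f x + f y) ->
  exists h, [/\ klinear h, supported h r & forall x, h r x = f x].
Proof.
move=> fl.
exists (fun s w => if @eqP _ s r is ReflectT e
  then f (ecast s (L s) e w) else 0); split.
- move=> s a w w'; case: eqP => [e|_]; last by rewrite mulr0 addr0.
  by case: r / e f fl.
- by move=> s w sr; case: eqP.
- by move=> x; case: eqP => // e; rewrite (eq_axiomK e).
Qed.

(** The functional is a coordinate of [x - projv W x], which vanishes on W but not at [v]. *)
Lemma separation (T : vectType k) (W : {vspace T}) v : v \notin W ->
  exists f : T -> k, [/\ (forall a x y, f (a *: x + y) = a * f x + f y),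
    (forall x, x \in W -> f x = 0) & f v != 0].
Proof.
move=> vW; have vn0 : v - projv W v != 0.
  by apply: contra vW; rewrite subr_eq0 => /eqP ->; exact: memv_proj.
pose c i := coord (vbasis {: T}) i.
have /existsP[i vi] : [exists i, c i (v - projv W v) != 0].
  apply: contra_neqT vn0; rewrite negb_exists => /forallP v0.
  rewrite [LHS](coord_vbasis (memvf _)) big1 // => i _.
  by have /eqP := negPn (v0 i); rewrite /c => ->; rewrite scale0r.
exists (fun x => c i (x - projv W x)); split=> //.
- move=> a x y; rewrite linearP opprD addrACA -scalerBr.
  exact: linearP.
- by move=> x xW; rewrite projv_id // subrr /c linear0.
Qed.

End Functionals.

(** * Derived series in positive degrees *)

Section Solvability.
Context (k : fieldType) (L : gradedLie k).
Implicit Types K Y V : graded_subspace L.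

Lemma derived_mono K K' : (forall i, (K i <= K' i)%VS) ->
  forall i, (derived K i <= derived K' i)%VS.
Proof.
move=> KK' i; apply: setspan_min => _ [a [b [e [x [y [xK yK ->]]]]]].
apply: mem_setspan; exists a, b, e, x, y; split=> //.
  exact: (subvP (KK' a)).
exact: (subvP (KK' b)).
Qed.

Lemma iter_derived_mono s K K' : (forall i, (K i <= K' i)%VS) ->
  forall i, (iter s (@derived k L) K i <= iter s (@derived k L) K' i)%VS.
Proof. by move=> KK'; elim: s => //= s; exact: derived_mono. Qed.

Lemma iter_derived_ideal s Y : lie_ideal Y ->
  forall i, (iter s (@derived k L) Y i <= Y i)%VS.
Proof.
move=> Yi; elim: s => //= s IH i.
apply: setspan_min => _ [a [b [e [x [y [_ yK ->]]]]]].
by apply: Yi; apply: (subvP (IH b)).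
Qed.

(** As L_0 = 0, a bracket with nonzero entries raises the degree, so each derived step empties one
    more degree. *)
Lemma iter_derived_low s K i : (i <= s)%N -> iter s (@derived k L) K i = 0%VS.
Proof.
have z0 (W : {vspace L 0}) : W = 0%VS.
  apply/eqP; rewrite -subv0; apply/subvP => x _.
  by rewrite [x]lie_comp0 mem0v.
elim: s i => [|s IH] i; first by rewrite leqn0 => /eqP ->.
move=> is1; apply/eqP; rewrite -subv0; apply: setspan_min.
move=> _ [a [b [e [x [y [xK yK ->]]]]]].
have [a0|a0] := posnP a.
  by move: x xK e; rewrite a0 => x _ e; rewrite [x]lie_comp0 br0l mem0v.
have : y \in (0%VS : {vspace L b}) by rewrite -(IH b) //; lia.
by rewrite memv0 => /eqP ->; rewrite br0r mem0v.
Qed.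

(** The n-th derived ideal of Y lives in degrees above n, so one further bracket lands in V, whose
    derived series ends. *)
Lemma almost_solvable n Y V : lie_ideal Y -> solvable V ->
  (forall i j m (e : (i + j)%N = m) (a : L i) (x : L j),
     (n < j)%N -> x \in Y j -> br e a x \in V m) ->
  solvable Y.
Proof.
move=> Yi [s sV] YV; exists (s + n.+1)%N => i.
apply/eqP; rewrite -subv0 -(sV i) iterD; apply: iter_derived_mono => {}i /=.
apply: setspan_min => _ [a [b [e [x [y [_ yK ->]]]]]].
have [bn|nb] := leqP b n; last first.
  by apply: YV => //; apply: (subvP (iter_derived_ideal n Yi b)).
move: yK; rewrite iter_derived_low // memv0 => /eqP ->.
by rewrite br0r mem0v.
Qed.

End Solvability.

(** * Euler operators counting the letters outside V *)

Section Euler.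
Context (k : fieldType) (L : gradedLie k) (V : graded_subspace L).
Context (Vi : lie_ideal V) (q n : nat) (z : U L).
Implicit Types (u v : U L) (g : functional L) (D E : nat -> U L -> U L).
Implicit Types (c : cochain L).

(** For z in [wt V q.+2 n], [qder_deg] gives D z the bound [q.+1]; here it is one smaller. *)
Definition null i D : Prop := wtd V i q n (D n z).

(** [c] is the value of [E] on [L] modulo [V]; it is the inclusion of [L] for a
  true Euler operator. *)
Record euler c E : Prop := Euler {
  euler_linear : forall d a u v, E d (a *: u + v) = a *: E d u + E d v;
  euler1 : E 0%N 1 = 0;
  eulerV : forall p i d (x : L i) u, x \in V i -> wt V p.+1 d u ->
    wt V p (i + d) (E (i + d)%N (iota x * u) - iota x * E d u);
  eulerL : forall p i d (x : L i) u, wt V p.+1 d u ->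
    wt V p.+1 (i + d)
      (E (i + d)%N (iota x * u) - c i x * u - iota x * E d u);
  euler_null : wt V q.+1 n (E n z)
}.

Lemma euler_zero : euler (fun _ _ => 0) (fun _ _ => 0).
Proof.
split=> //.
- by move=> *; rewrite scaler0 addr0.
- by move=> *; rewrite mulr0 subr0; exact: wt0.
- by move=> *; rewrite mul0r mulr0 !subr0; exact: wt0.
- exact: wt0.
Qed.

Lemma euler_add c c' E E' : euler c E -> euler c' E' ->
  euler (fun i x => c i x + c' i x) (fun d u => E d u + E' d u).
Proof.
move=> [El E1 EV EL En] [El' E1' EV' EL' En']; split.
- by move=> d a u v; rewrite El El' scalerDr addrACA.
- by rewrite E1 E1' addr0.
- move=> p i d x u xV hu; rewrite mulrDr opprD addrACA.
  by apply: wtD; auto.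
- move=> p i d x u hu; rewrite mulrDr mulrDl !opprD.
  by rewrite (AC (2*2*2) (1*3*5*(2*4*6))) /=; apply: wtD; auto.
- exact: wtD.
Qed.

(** Moving y past x costs [x, y] D u, which has admissible weight because [x, y] lies in V whenever
    x does. *)
Lemma euler_qder m g D (y : L m) : qder V m g D -> null m D ->
  euler (fun i x => g i x *: iota y) (fun d u => iota y * D d u).
Proof.
move=> [gl gs gV Dl D1 Dd eV eL] Dn.
have yx i d (x : L i) u :
    iota y * ((-1) ^+ (i * m) *: (iota x * D d u)) - iota x * (iota y * D d u)
    = - (iota (br erefl x y) * D d u).
  rewrite (mulrA (iota x)) iota_swap mulrDl -scalerAl -scalerAr !mulrA.
  by rewrite opprD addrC subrK.
split.
- by move=> d a u v; rewrite Dl mulrDr scalerAr.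
- by rewrite D1 mulr0.
- move=> p i d x u xV hu; move: (eV i d x u xV).
  rewrite /qerr gV // scale0r subr0 => /eqP; rewrite subr_eq0 => /eqP ->.
  rewrite yx; apply: wtN; apply: wtdKV (Dd _ _ _ hu).
  exact: ideal_brl.
- move=> p i d x u hu.
  have -> : iota y * D (i + d)%N (iota x * u) - g i x *: iota y * u
      - iota x * (iota y * D d u) =
      iota y * qerr m g D d x u - iota (br erefl x y) * D d u.
    rewrite -yx /qerr !mulrBr -scalerAl -scalerAr.
    by rewrite [RHS]addrA subrK.
  apply: wtB; first by apply: wtdK; exact: eL.
  by apply: wtdKL; exact: Dd.
- exact: wtdK.
Qed.

(** Gaussian elimination: while a subspace A of L_m is not inside V, [sep] gives a null [D] whose
    symbol is nonzero on A; restrict to the kernel of this symbol in A, then correct by a term y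
    D. *)
Lemma euler_degree m :
  (forall x : L m, (forall g D, qder V m g D -> null m D -> g m x = 0) ->
     x \in V m) ->
  exists c E (t : L m -> L m), [/\ euler c E,
    forall i x, i <> m -> c i x = 0, forall x, c m x = iota (t x) &
    forall x, x - t x \in V m].
Proof.
move=> sep.
suff H N (A : {vspace L m}) : (\dim A < N)%N ->
    exists c E (t : L m -> L m), [/\ euler c E,
      forall i x, i <> m -> c i x = 0, forall x, c m x = iota (t x),
      forall a x y, t (a *: x + y) = a *: t x + t y &
      forall x, x \in A -> x - t x \in V m].
  have [c [E [t [cE cm ct tl tV]]]] := H _ {: L m}%VS (leqnn _).
  by exists c, E, t; split=> // x; apply: tV; exact: memvf.
elim: N A => // N IH A dA.
have [AV|AV] := boolP (A <= V m)%VS.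
  exists (fun _ _ => 0), (fun _ _ => 0), (fun _ => 0); split=> //.
  - exact: euler_zero.
  - by move=> x; rewrite iota0.
  - by move=> a x y; rewrite scaler0 addr0.
  - by move=> x xA; rewrite subr0; exact: (subvP AV).
have [x0 x0A x0V] := subvPn AV.
have [g [D [gD Dn gx0]]] : exists g D, [/\ qder V m g D, null m D & g m x0 != 0].
  apply: contrapT => no; move/negP: x0V; apply; apply: sep => g D gD Dn.
  by apply: contrapT => /eqP gx0; apply: no; exists g, D.
have gl := qder_klinear gD.
have [W WE] := klinear_kernel m gl.
have dAW : (\dim (A :&: W)%VS < N)%N.
  apply: leq_trans _ (ltnSE dA); rewrite ltn_neqAle dimvS ?capvSl // andbT.
  apply/eqP => dE; have /eqP AW : (A :&: W == A)%VS by rewrite eqEdim capvSl dE /=.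
  by move: x0A; rewrite -AW memv_cap WE (negPf gx0) andbF.
have [c [E [t [cE cm ct tl tV]]]] := IH _ dAW.
(* Chosen so that the new [t] fixes [x0]; on the kernel of [g m] it agrees with the old one. *)
pose y := (g m x0)^-1 *: (x0 - t x0).
exists (fun i x => c i x + g i x *: iota y), (fun d u => E d u + iota y * D d u),
  (fun x => t x + g m x *: y); split.
- by apply: euler_add => //; exact: euler_qder.
- move=> i x im; rewrite cm // (qder_supported gD) // scale0r addr0 //.
- by move=> x; rewrite ct addrC -iota_linear addrC.
- move=> a u v; by rewrite tl gl scalerDl -scalerA scalerDr addrACA.
- move=> x xA; pose b := g m x / g m x0.
  have : (- b) *: x0 + x \in (A :&: W)%VS.
    rewrite memv_cap; apply/andP; split; first by apply: rpredD => //; exact: rpredZ.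
    by rewrite WE gl /b mulNr divfK // addNr.
  move=> /tV; rewrite tl => H.
  rewrite (_ : x - _ = - b *: x0 + x - (- b *: t x0 + t x)) //.
  rewrite /y scalerA -/b scalerBr !scaleNr !opprD !opprK.
  by rewrite [RHS](AC (2*2) (2*(4*(1*3)))).
Qed.

Lemma euler_all N :
  (forall m (x : L m), (m < N)%N ->
     (forall g D, qder V m g D -> null m D -> g m x = 0) -> x \in V m) ->
  exists c E, [/\ euler c E, forall i x, (N <= i)%N -> c i x = 0 &
    forall i x, (i < N)%N -> exists2 v, v \in V i & iota x - c i x = iota v].
Proof.
elim: N => [|N IH] sep.
  by exists (fun _ _ => 0), (fun _ _ => 0); split=> //; exact: euler_zero.
have [|c [E [cE c0 cV]]] := IH.
  by move=> m x mN; apply: sep; exact: leqW.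
have [c' [E' [t [cE' cN' ct tV]]]] := euler_degree (fun x => sep N x (leqnn _)).
exists (fun i x => c i x + c' i x), (fun d u => E d u + E' d u); split.
- exact: euler_add.
- by move=> i x Ni; rewrite c0 ?cN' ?addr0 //; lia.
- move=> i x; rewrite ltnS leq_eqVlt => /orP[/eqP iN|iN]; last first.
    have [v vV xv] := cV i x iN; exists v => //.
    by rewrite cN' ?addr0 //; lia.
  subst i; exists (x - t x) => //; rewrite c0 // add0r ct addrC.
  by have := iota_linear (-1) (t x) x; rewrite !scaleN1r [- t x + _]addrC => ->.
Qed.

(** A letter of V contributes 0 and any other letter 1, since [c] is the inclusion modulo V in
    degrees up to n; a word at the top of [wt V p] has [p.-1] letters of the second kind. *)
Lemma euler_degree_shift c E : euler c E ->
  (forall i (x : L i), (i <= n)%N ->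
     exists2 v, v \in V i & iota x - c i x = iota v) ->
  forall p d u, wt V p d u -> (d <= n)%N ->
  wt V p.-1 d (E d u - p.-1%:R *: u).
Proof.
move=> [El E1 EV EL _] cV p d u.
have E0 r : E r 0 = 0.
  by have := El r (-1) 0 0; rewrite scaler0 addr0 scaleN1r addNr.
elim=> {p d u}.
- by move=> p d _; rewrite E0 scaler0 subrr; exact: wt0.
- move=> [|p] _; rewrite E1 sub0r -scaleNr.
    by rewrite oppr0 scale0r; exact: wt0.
  by apply: wtZ; exact: wt1.
- move=> p d a u v _ IHu _ IHv dn.
  rewrite El scalerDr scalerA mulrC -scalerA opprD addrACA -scalerBr.
  by apply: wtP; auto.
- move=> [|p] d i x u xV hu IH dn.
    rewrite (wt_nil hu) // mulr0 scaler0 subr0.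
    by rewrite E0; exact: wt0.
  have -> : E (i + d)%N (iota x * u) - p%:R *: (iota x * u) =
      (E (i + d)%N (iota x * u) - iota x * E d u)
      + iota x * (E d u - p%:R *: u).
    by rewrite mulrBr -scalerAr addrA subrK.
  apply: wtD; first exact: EV.
  by apply: wtV => //; apply: IH; lia.
- move=> [|p] d i x u hu IH dn.
    rewrite (wt_nil hu) // mulr0 scaler0 subr0.
    by rewrite E0; exact: wt0.
  have [|v vV xv] := cV i x; first by lia.
  have -> : E (i + d)%N (iota x * u) - p.+1%:R *: (iota x * u) =
      (E (i + d)%N (iota x * u) - c i x * u - iota x * E d u)
      + iota x * (E d u - p%:R *: u) - iota v * u.
    rewrite -xv mulrBl mulrBr -scalerAr addrA subrK opprB addrA.
    rewrite -natr1 scalerDl scale1r opprD.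
    by rewrite [RHS](ACl (1*(3*5)*(4*2))) /= subrr addr0.
  apply: wtB; first apply: wtD.
  + exact: EL.
  + by apply: wtL; apply: IH; lia.
  + by apply: wtV => //; exact: hu.
Qed.

End Euler.

(** * Lowering the weight of a central element *)

Section Descent.
Context (k : fieldType) (char0 : [pchar k]%R =i pred0).
Context (L : gradedLie k) (V : graded_subspace L).
Context (Vi : lie_ideal V) (Vs : solvable V).
Context (q n : nat) (z : U L).
Context (zwt : wt V q.+2 n z) (zC : forall l (a : L l), uad a n z = 0).

(** [setspan] only turns into a [vspace] a set that is already a subspace, as [nullspaceP]
    confirms. *)
Definition nullspace : graded_subspace L := fun i =>
  setspan [set x | forall g D, qder V i g D -> null V q n z i D -> g i x = 0].

Lemma nullspaceP i (x : L i) : x \in nullspace i ->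
  forall g D, qder V i g D -> null V q n z i D -> g i x = 0.
Proof.
move=> xN g D gD Dn; have [W WE] := klinear_kernel i (qder_klinear gD).
apply/eqP; rewrite -WE; apply: subvP xN; apply: setspan_min => y yN.
by rewrite WE; apply/eqP; exact: yN gD Dn.
Qed.

(** Since (ad a) z = 0, the commutator of ad a and D sends z to (ad a)(D z), so it is null when D
    is; its symbol at x is g([a, x]) up to sign. *)
Lemma nullspace_ideal : lie_ideal nullspace.
Proof.
move=> l m r e a x xN; case: r / e; apply: mem_setspan => g D gD Dn.
have D0 : D (l + n)%N 0 = 0.
  by have := qder_linear gD (l + n)%N (-1) 0 0; rewrite scaler0 addr0 scaleN1r addNr.
have := nullspaceP xN (qder_ad Vi a gD).
rewrite /null /adder zC D0 scaler0 subr0 /adsym => /(_ (wtd_ad Vi a Dn)) /eqP.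
by rewrite mulf_eq0 oppr_eq0 signr_eq0 => /eqP.
Qed.

Lemma sub_nullspace i : (V i <= nullspace i)%VS.
Proof.
by apply/subvP => x xV; apply: mem_setspan => g D gD _; exact: qder_kills gD _ _ xV.
Qed.

(** An operator of degree below -n kills z and so is null. If [x, a] were outside V, contracting
    with a functional that separates it from V would give such an operator with nonzero symbol at
    x. *)
Lemma nullspace_high i j r (e : (i + j)%N = r) (a : L i) (x : L j) :
  (n < j)%N -> x \in nullspace j -> br e a x \in V r.
Proof.
move=> nj xN; have e' : (j + i)%N = r by rewrite addnC.
rewrite (br_anti e e') rpredN rpredZ //; case: r / e' e => _.
apply/negPn/negP => /separation[f [fl fV fx]].
have [h [hl hr hf]] := functional_single fl.
have hV : kills V h.
  move=> s w; case: (@eqP _ (j + i)%N s) => [E|ne _].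
    by case: s / E w => w wV; rewrite hf fV.
  by apply: hr => E; exact: ne.
have gD := qder_contr Vi a (leq_ltn_trans (leq0n n) nj) hl hV hr.
have := nullspaceP xN gD; rewrite /null (_ : contr _ _ _ _ _ = 0); last first.
  by have [_ ->] := qder_deg gD zwt.
move=> /(_ (wtd0 _ _ _ _)) /eqP.
by rewrite /adf mulf_eq0 signr_eq0 hf (negPf fx).
Qed.

Lemma nullspace_solvable : solvable nullspace.
Proof. exact: almost_solvable nullspace_ideal Vs nullspace_high. Qed.

Lemma wt_descent :
  (forall Y, lie_ideal Y -> solvable Y -> (forall i, (V i <= Y i)%VS) ->
     forall i, (i <= n)%N -> (Y i <= V i)%VS) ->
  wt V q.+1 n z.
Proof.
move=> Vmax.
have NV := Vmax _ nullspace_ideal nullspace_solvable sub_nullspace.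
have [|c [E [cE _ cV]]] := @euler_all _ _ _ Vi q n z n.+1.
  by move=> m x mn xN; apply: (subvP (NV m _)) => //; exact: mem_setspan.
(* Both E z and E z - (q+1) z have the smaller weight; q + 1 is invertible in characteristic
   zero. *)
have := wtB (euler_null cE) (euler_degree_shift cE cV zwt (leqnn n)).
rewrite opprB addrC subrK => /(wtZ (q.+1%:R^-1)).
rewrite scalerA mulVf ?scale1r //.
by move/pcharf0P: char0 => ->.
Qed.

End Descent.

(** The radical itself may fail to be solvable. In degrees up to n, however, the total dimension of
    a solvable ideal is bounded, so it can be maximized. *)
Lemma max_solvable_ideal (k : fieldType) (L : gradedLie k) n :
  exists V : graded_subspace L, [/\ lie_ideal V, solvable V &
    forall Y, lie_ideal Y -> solvable Y -> (forall i, (V i <= Y i)%VS) ->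
      forall i, (i <= n)%N -> (Y i <= V i)%VS].
Proof.
pose d (V : graded_subspace L) := (\sum_(i < n.+1) \dim (V i))%N.
pose P s := `[< exists V, [/\ lie_ideal V, solvable V & d V = s] >].
have exP : exists s, P s.
  exists (d (fun=> 0%VS)); apply/asboolP; exists (fun=> 0%VS); split=> //.
    by move=> i j m e x y; rewrite memv0 => /eqP ->; rewrite br0r mem0v.
  by exists 0%N.
have leP s : P s -> (s <= \sum_(i < n.+1) \dim {: L i})%N.
  move=> /asboolP[V [_ _ <-]]; apply: leq_sum => i _; exact/dimvS/subvf.
case: (ex_maxnP exP leP) => s /asboolP[V [Vi Vs dV]] maxs.
exists V; split=> // Y Yi Ys VY i iN.
have dY : (d Y <= d V)%N by rewrite dV; apply: maxs; apply/asboolP; exists Y.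
rewrite -(geq_leqif (dimv_leqif_sup (VY i))) leqNgt; apply/negP => lt.
move: dY; rewrite leqNgt => /negP; apply.
pose i' := Ordinal (iN : i < n.+1)%N.
rewrite /d (bigD1 i') //= [X in (_ < X)%N](bigD1 i') //=.
by rewrite -addSn leq_add //; apply: leq_sum => j _; exact: dimvS.
Qed.

(** * Homogeneous components of central elements *)

Section Center.
Context (k : fieldType) (L : gradedLie k).
Implicit Types u v z : U L.

Lemma ucompD m u v : ucomp m (u + v) = ucomp m u + ucomp m v.
Proof. by rewrite /ucomp ugrD coefD. Qed.

Lemma ucomp0 m : ucomp m 0 = 0 :> U L.
Proof. by rewrite (ucomp_id (uhomog0 L m)) if_same. Qed.

Lemma ucomp_sum_homog m w (F : nat -> U L -> U L) : uhomog m w ->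
  (forall j, F j 0 = 0) -> \sum_(j < size (ugr w)) F j (ucomp j w) = F m w.
Proof.
move=> hw F0; have wE := ucomp_id hw.
rewrite (eq_bigr (fun j : 'I__ => if val j == m then F m w else 0)); last first.
  by move=> j _; rewrite wE; case: eqP => [->|].
rewrite -big_mkcond /=; case: (ltnP m (size (ugr w))) => [mw|wm].
  by rewrite (big_pred1 (Ordinal mw)) // => j; rewrite -val_eqE.
rewrite big_pred0; last by move=> j; apply/eqP => jm; move: wm; rewrite -jm leqNgt ltn_ord.
have -> : w = 0 by have := wE m; rewrite eqxx /ucomp nth_default.
by rewrite F0.
Qed.

(** In the commutator of z with [a], the component of z of degree i contributes in degree i + l, so
    these contributions vanish separately. *)
Lemma center_component z n l (a : L l) : Z L z -> uad a n (ucomp n z) = 0.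
Proof.
pose t i := ucomp i z * iota a - (-1) ^+ (i * l) *: (iota a * ucomp i z).
move=> /(_ (iota a)); rewrite /gcomm.
rewrite (eq_bigr (fun i : 'I_(size (ugr z)) => t i)); last first.
  move=> i _; have := @ucomp_sum_homog l (iota a) (fun j v =>
    ucomp i z * v - (-1) ^+ (i * j) *: (v * ucomp i z)) (uhomog_iota a).
  by apply=> j; rewrite mulr0 mul0r scaler0 subr0.
move=> /(congr1 (ucomp (n + l))); rewrite ucomp0.
have tE i : ucomp (n + l) (t i) = if i == n then t n else 0.
  have ht : uhomog (i + l) (t i).
    apply: uhomogD; first by apply: uhomogMM (uhomog_iota a); exact: ucomp_homog.
    rewrite -scaleNr addnC; apply: uhomogZ.
    by apply: uhomogMM; [exact: uhomog_iota|exact: ucomp_homog].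
  by rewrite (ucomp_id ht) eqn_add2r eq_sym; case: eqP => [->|].
rewrite (big_morph _ (ucompD (n + l)) (ucomp0 _)).
rewrite (eq_bigr (fun i : 'I__ => if val i == n then t n else 0) (fun i _ => tE i)).
(* [gcomm] and [uad] take the two factors in opposite orders; the sign relating them squares to
   1. *)
have tn : t n = 0 -> uad a n (ucomp n z) = 0.
  move=> /eqP; rewrite subr_eq0 => /eqP E.
  by rewrite /uad E scalerA [(l * n)%N]mulnC -expr2 sqrr_sign scale1r subrr.
rewrite -big_mkcond /=; case: (ltnP n (size (ugr z))) => [nz|zn].
  by rewrite (big_pred1 (Ordinal nz)) // => i; rewrite -val_eqE.
by rewrite /ucomp nth_default // => _; exact: uad0.
Qed.

End Center.

(** * The subalgebra UR(L) and words in a solvable ideal *)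

Section RadicalImage.
Context (k : fieldType) (L : gradedLie k).
Implicit Types u v : U L.

Let morph := ulift_morphism (@iota_radical_morphism k L).

Lemma UR0 : UR L 0.
Proof.
have [_ lin _] := morph; exists 0 => //.
by have := lin (-1) 0 0; rewrite scaler0 addr0 scaleN1r addNr.
Qed.

Lemma UR1 : UR L 1.
Proof. by have [one _ _] := morph; exists 1. Qed.

Lemma URP a u v : UR L u -> UR L v -> UR L (a *: u + v).
Proof.
have [_ lin _] := morph; move=> [u' _ <-] [v' _ <-].
by exists (a *: u' + v').
Qed.

Lemma URM u v : UR L u -> UR L v -> UR L (u * v).
Proof.
have [_ _ mult] := morph; move=> [u' _ <-] [v' _ <-].
by exists (u' * v').
Qed.

Lemma UR_iota i (x : L i) : x \in radical L i -> UR L (iota x).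
Proof.
move=> xR; exists (@Defs.iota k (radicalLie L) i (vsproj (radical L i) x)) => //.
rewrite uliftE; last exact: iota_radical_morphism.
by rewrite /iota_radical vsprojK.
Qed.

Lemma wt1_UR (V : graded_subspace L) p d u : lie_ideal V -> solvable V ->
  wt V p d u -> (p <= 1)%N -> UR L u.
Proof.
move=> Vi Vs; elim=> {p d u}.
- by move=> *; exact: UR0.
- by move=> *; exact: UR1.
- by move=> p d a u v _ IHu _ IHv p1; apply: URP; auto.
- move=> p d i x u xV _ IH p1; apply: URM; last exact: IH.
  by apply: UR_iota; apply: mem_setspan; exists V.
- move=> [|//] d i x u hu _ _.
  by rewrite (wt_nil hu) // mulr0; exact: UR0.
Qed.

End RadicalImage.

Theorem theoremE (k : fieldType) (char0 : [pchar k]%R =i pred0)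
    (L : gradedLie k) :
  Z L `<=` UR L.
Proof.
move=> z zZ; rewrite (ucomp_sum z).
elim/big_ind: _ => [|u v hu hv|[n /= _] _]; first exact: UR0.
  by rewrite -[u]scale1r; exact: URP.
(* V depends on the degree n of the component but not on the weight, so the descent can be iterated
   down to weight 1. *)
have [V [Vi Vs Vmax]] := max_solvable_ideal L n.
have [p] := wt_homog V (ucomp_homog n z).
have wt_le1 q : wt V q.+1 n (ucomp n z) -> wt V 1 n (ucomp n z).
  elim: q => // q IH hq; apply: IH; apply: wt_descent hq _ Vmax => // l a.
  exact: center_component.
case: p => [|p] hp; first exact: wt1_UR hp _.
exact: wt1_UR (wt_le1 _ hp) _.
Qed.
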